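(* Let $\Omega$ be a countable algebraic language and $\mathbf{V}$ a nontrivial variety of $\Omega$-algebras. Let $\mathbf{C}$ be the category whose objects are the well-ordered algebras $(A, \Omega^A, <)$ where $(A, \Omega^A) \in \mathbf{V}$ and $<$ is a well-ordering of $A$, and whose morphisms are the rigid epimorphisms. Then every finite ordered $\mathbf{V}$-algebra has finite big dual Ramsey degree in $\hat{\mathcal{F}}_{\mathbf{V}}(\omega)$ with respect to Borel colorings. More precisely, for every finite object $\mathcal{A} = (A, \Omega^A, <)$ of $\mathbf{C}$, $$ T^{\flat\partial}_{\mathbf{C}}(\mathcal{A}, \hat{\mathcal{F}}_{\mathbf{V}}(\omega)) \le |A|. $$
   Context: Algebras. An algebraic language $\Omega$ is a set of constant and functional symbols (of finite arities); fix well-orderings of the set $\Omega_C$ of constant symbols and of the set $\Omega_F$ of functional symbols, and order $\Omega=\Omega_C\oplus\Omega_F$ (constants first). An $\Omega$-algebra is a nonempty set with an operation for each symbol of $\Omega$. A variety is the class of all $\Omega$-algebras satisfying some set of identities between $\Omega$-terms; it is nontrivial if it contains an algebra with at least two elements. Epimorphism of algebras means surjective homomorphism. Rigid epimorphisms. For well-ordered chains $(A,<)$, $(B,<)$, a surjective map $f:A\to B$ is a rigid surjection if $b_1<b_2$ implies $\min f^{-1}(b_1)<\min f^{-1}(b_2)$. A rigid epimorphism between well-ordered $\Omega$-algebras is a map that is both an epimorphism of algebras and a rigid surjection of the underlying chains. The ordered free algebra $\hat{\mathcal{F}}_{\mathbf{V}}(\omega)$. For a nonempty well-ordered chain $\mathcal{X}=(X,<)$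 of variables let $T(X)$ be the set of all $\Omega$-terms over $X$, viewed as strings of symbols, let $\xi = \min\mathcal{X}$, and let the shape of a term be the term obtained by replacing each occurrence of a variable by $\xi$. Let $S_n$ be the set of all shapes of length $n$, ordered lexicographically with respect to $\{\xi\}\oplus\Omega\oplus\{\text{``(''}<\text{``,''}<\text{``)''}\}$. For a shape $\sigma$ let $T_\sigma(X)$ be the set of terms of shape $\sigma$, ordered lexicographically with respect to $\mathcal{X}\oplus\Omega\oplus\{\text{``(''}<\text{``,''}<\text{``)''}\}$. The neat well-ordering of $T(X)$ is the ordinal sum $\left(\bigoplus_{\sigma\in S_1}T_\sigma(X)\right)\oplus\left(\bigoplus_{\sigma\in S_2}T_\sigma(X)\right)\oplus\cdots$. Let $\Theta_{\mathbf{V}}(X)=\{(t_1,t_2)\in T(X)^2:\mathbf{V}\models t_1\approx t_2\}$, let $T_{\mathbf{V}}(X)=T(X)/\Theta_{\mathbf{V}}(X)$ be the carrier of the free $\mathbf{V}$-algebra $\mathcal{F}_{\mathbf{V}}(X)$, and let $\nu:T(X)\to T_{\mathbf{V}}(X)$ be the quotient map. There is a unique well-ordering of $T_{\mathbf{V}}(X)$ making $\nu$ a rigid surjection from $T(X)$ with the neat well-ordering (classes are compared by their least elements). $\hat{\mathcal{F}}_{\mathbf{V}}(\mathcal{X})$ denotes $\mathcal{F}_{\mathbf{V}}(X)$ with this well-ordering; $\hat{\mathcal{F}}_{\mathbf{V}}(\omega)$ is the case $\mathcal{X}=\omega=\{0<1<2<\cdots\}$. Degrees. Each hom-set $\hom_{\mathbf{C}}(\mathcal{A},\mathcal{B})$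 carries the subspace topology inherited from the Tychonoff topology on $B^A$ with $A$ and $B$ discrete, $A,B$ being the underlying sets. A Borel $k$-coloring of a topological space $X$ is a map $\chi:X\to\{0,\dots,k-1\}$ such that each $\chi^{-1}(i)$ is a Borel set. For objects $\mathcal{A},\mathcal{S}$ of $\mathbf{C}$, $T^{\flat\partial}_{\mathbf{C}}(\mathcal{A},\mathcal{S})$, the big dual Ramsey degree of $\mathcal{A}$ in $\mathcal{S}$ with respect to Borel colorings, is the least positive integer $n$ such that for every $k\ge2$ and every Borel $k$-coloring $\chi$ of $\hom_{\mathbf{C}}(\mathcal{S},\mathcal{A})$ there is a $w\in\hom_{\mathbf{C}}(\mathcal{S},\mathcal{S})$ with $|\chi(\{f\cdot w:f\in\hom_{\mathbf{C}}(\mathcal{S},\mathcal{A})\})|\le n$; it is $\infty$ if there is no such $n$. *)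

(* Defs.v *)
From HB Require Import structures.
From mathcomp Require Import all_boot.
From mathcomp Require Import all_classical topology function_spaces.
From mathcomp Require Import discrete_topology subtype_topology.
From mathcomp Require Import measurable_structure.

Set Implicit Arguments.
Unset Strict Implicit.
Unset Printing Implicit Defensive.

Local Open Scope classical_set_scope.
Local Open Scope quotient_scope.
Local Open Scope card_scope.

Record well_ordering (T : Type) (lt : T -> T -> Prop) : Prop := WellOrdering {
  wo_trans : forall x y z, lt x y -> lt y z -> lt x z;
  wo_total : forall x y, lt x y \/ x = y \/ lt y x;
  wo_wf : well_founded lt
}.

Definition least (T : Type) (lt : T -> T -> Prop) (P : set T) (x : T) : Prop :=
  P x /\ forall y, P y -> ~ lt y x.

Definition rigid_surjection (A B : Type) (ltA : A -> A -> Prop)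
    (ltB : B -> B -> Prop) (f : A -> B) : Prop :=
  (forall b, exists a, f a = b) /\
  forall b1 b2 a1 a2, ltB b1 b2 ->
    least ltA (f @^-1` [set b1]) a1 -> least ltA (f @^-1` [set b2]) a2 ->
    ltA a1 a2.

Record chain := Chain {
  chain_sort :> Type;
  chain_lt : chain_sort -> chain_sort -> Prop;
  chain_wo : well_ordering chain_lt;
  chain_min : chain_sort;
  chain_minP : least (@chain_lt) [set: chain_sort] chain_min
}.

Section WellOrderingTheory.
Context (T : Type) (lt : T -> T -> Prop) (wo : well_ordering lt).

Lemma wo_irr x : ~ lt x x.
Proof. by elim/(well_founded_ind (wo_wf wo)): x => x IH h; exact: (IH x h h). Qed.

Lemma ex_least (P : set T) x : P x -> exists y, least lt P y.
Proof.
elim/(well_founded_ind (wo_wf wo)): x => x IH Px.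
have [[y [Py yx]]|n] := pselect (exists y, P y /\ lt y x); first exact: IH Py.
by exists x; split=> // y Py yx; apply: n; exists y.
Qed.

Lemma least_uniq (P : set T) x y : least lt P x -> least lt P y -> x = y.
Proof.
move=> [Px hx] [Py hy].
by have [/(hy _ Px)|[//|/(hx _ Py)]] := wo_total wo x y.
Qed.

End WellOrderingTheory.

Lemma wf_least (T : Type) (lt : T -> T -> Prop) :
  (forall (P : set T) x, P x -> exists y, least lt P y) -> well_founded lt.
Proof.
move=> h x; apply: contrapT => nx.
have [y [/= ny ymin]] := h (fun z => ~ Acc lt z) x nx.
by apply: ny; constructor=> z zy; apply: contrapT => /ymin.
Qed.

Lemma rigid_surjection_comp (A B C : Type) (ltA : A -> A -> Prop)
    (ltB : B -> B -> Prop) (ltC : C -> C -> Prop) (f : A -> B) (g : B -> C) :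
  well_ordering ltA -> well_ordering ltB ->
  rigid_surjection ltA ltB f -> rigid_surjection ltB ltC g ->
  rigid_surjection ltA ltC (g \o f).
Proof.
move=> woA woB [fs fr] [gs gr]; split=> [c|c1 c2 a1 a2 c12 h1 h2].
  by have [b <-] := gs c; have [a <-] := fs b; exists a.
have key c a : least ltA ((g \o f) @^-1` [set c]) a ->
    exists2 b, least ltB (g @^-1` [set c]) b & least ltA (f @^-1` [set b]) a.
  move=> [/= fa amin].
  have [b [/= gb bmin]] := @ex_least _ _ woB (g @^-1` [set c]) (f a) fa.
  have [a0 fa0] := fs b.
  have [a' [/= fa' a'min]] := @ex_least _ _ woA (f @^-1` [set b]) a0 fa0.
  have na'a : ~ ltA a' a by apply: amin; rewrite /= fa'.
  have fab : f a = b.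
    have [bf|[//|/(bmin _ fa)//]] := wo_total woB b (f a).
    have [a3 a3l] := @ex_least _ _ woA (f @^-1` [set f a]) a erefl.
    have a'a3 := fr _ _ _ _ bf (conj fa' a'min) a3l.
    by case: na'a; have [aa3|[->//|a3a]] := wo_total woA a a3;
      [case: (a3l.2 a erefl aa3)|exact: wo_trans a3a].
  exists b => //; split=> //= y fy; apply: amin; by rewrite /= fy.
have [b1 hb1 ha1] := key _ _ h1; have [b2 hb2 ha2] := key _ _ h2.
exact: fr (gr _ _ _ _ c12 hb1 hb2) ha1 ha2.
Qed.

(* Constants are kept apart from functional symbols, hence positive arities. *)
Record language := Language {
  const : Type;
  func : Type;
  arity : func -> nat;
  arity_gt0 : forall f, (0 < arity f)%N;
  const_lt : const -> const -> Prop;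
  func_lt : func -> func -> Prop;
  const_wo : well_ordering const_lt;
  func_wo : well_ordering func_lt
}.

Definition countable_language (L : language) : Prop :=
  countable [set: const L] /\ countable [set: func L].

Inductive term (L : language) (X : Type) : Type :=
| Var of X
| Cst of const L
| App (f : func L) of ('I_(arity f) -> term L X).
Arguments Var {L X}.
Arguments Cst {L X}.

HB.instance Definition _ L X := gen_eqMixin (term L X).
HB.instance Definition _ L X := gen_choiceMixin (term L X).

Record algebra (L : language) := Algebra {
  alg_sort :> Type;
  alg_nonempty : inhabited alg_sort;
  alg_const : const L -> alg_sort;
  alg_func : forall f : func L, ('I_(arity f) -> alg_sort) -> alg_sort
}.

Section Terms.
Context (L : language).

Fixpoint eval (X : Type) (A : algebra L) (e : X -> A) (t : term L X) : A :=
  match t with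
  | Var x => e x
  | Cst c => alg_const A c
  | App f a => alg_func (fun i => eval e (a i))
  end.

Definition satisfies (X : Type) (A : algebra L) (s t : term L X) : Prop :=
  forall e : X -> A, eval e s = eval e t.

Definition homomorphism (A B : algebra L) (h : A -> B) : Prop :=
  (forall c, h (alg_const A c) = alg_const B c) /\
  (forall (f : func L) (a : 'I_(arity f) -> A),
     h (alg_func a) = alg_func (fun i => h (a i))).

Record variety := Variety {
  in_variety :> algebra L -> Prop;
  varietyP : exists E : set (term L nat * term L nat), forall A,
    in_variety A <-> forall p, E p -> satisfies A p.1 p.2
}.

Definition nontrivial_variety (V : variety) : Prop :=
  exists2 A : algebra L, V A & exists x y : A, x <> y.

Fixpoint subst (X Y : Type) (g : X -> term L Y) (t : term L X) : term L Y :=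
  match t with
  | Var x => g x
  | Cst c => Cst c
  | App f a => App (fun i => subst g (a i))
  end.

Lemma eval_subst X Y (A : algebra L) (e : Y -> A) (g : X -> term L Y) t :
  eval e (subst g t) = eval (fun x => eval e (g x)) t.
Proof. by elim: t => //= f a IH; congr alg_func; apply/funext. Qed.

End Terms.
Arguments satisfies {L X}.

Inductive symbol (L : language) (X : Type) : Type :=
| SVar of X | SConst of const L | SFunc of func L | SLeft | SComma | SRight.
Arguments SVar {L X}.
Arguments SConst {L X}.
Arguments SFunc {L X}.
Arguments SLeft {L X}.
Arguments SComma {L X}.
Arguments SRight {L X}.

Section Strings.
Context (L : language).

Fixpoint comma_sep (X : Type) (ss : seq (seq (symbol L X))) :
    seq (symbol L X) :=
  match ss with
  | [::] => [::]
  | [:: s] => s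
  | s :: ss' => s ++ SComma :: comma_sep ss'
  end.

Fixpoint term_string (X : Type) (t : term L X) : seq (symbol L X) :=
  match t with
  | Var x => [:: SVar x]
  | Cst c => [:: SConst c]
  | App f a =>
      SFunc f :: SLeft ::
        rcons (comma_sep [seq term_string (a i) | i <- enum 'I_(arity f)])
          SRight
  end.

Fixpoint lex (T : Type) (lt : T -> T -> Prop) (u v : seq T) : Prop :=
  match u, v with
  | _, [::] => False
  | [::], _ :: _ => True
  | x :: u', y :: v' => lt x y \/ (x = y /\ lex lt u' v')
  end.

Context (X : chain).

Definition symbol_lt (s t : symbol L X) : Prop :=
  match s, t with
  | SVar x, SVar y => chain_lt x y
  | SVar _, _ => True
  | _, SVar _ => False
  | SConst c, SConst d => const_lt c d
  | SConst _, _ => True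
  | _, SConst _ => False
  | SFunc f, SFunc g => func_lt f g
  | SFunc _, _ => True
  | _, SFunc _ => False
  | SLeft, SLeft => False
  | SLeft, _ => True
  | SComma, SRight => True
  | _, _ => False
  end.

Definition shape (t : term L X) : term L X :=
  subst (fun=> Var (chain_min X)) t.

Definition term_length (t : term L X) : nat := size (term_string t).

(* The only variable occurring in a shape is [chain_min X], so on shapes
   [symbol_lt] is the order {xi} + L + {"(" < "," < ")"}. *)
Definition neat_lt (s t : term L X) : Prop :=
  (term_length s < term_length t)%N \/
  term_length s = term_length t /\
    (lex symbol_lt (term_string (shape s)) (term_string (shape t)) \/
     shape s = shape t /\ lex symbol_lt (term_string s) (term_string t)).

Lemma symbol_wo : well_ordering symbol_lt.
Proof.
split.
- by move=> [x|c|f|||] [y|d|g|||] [z|e|h|||] //=;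
    [exact: wo_trans (chain_wo X) _ _ _|exact: wo_trans (const_wo L) _ _ _
    |exact: wo_trans (func_wo L) _ _ _].
- move=> [x|c|f|||] [y|d|g|||] /=; try by [left|right; left|right; right].
  + by have [|[->|]] := wo_total (chain_wo X) x y; [left|right; left|right; right].
  + by have [|[->|]] := wo_total (const_wo L) c d; [left|right; left|right; right].
  + by have [|[->|]] := wo_total (func_wo L) f g; [left|right; left|right; right].
- have av x : Acc symbol_lt (SVar x).
    elim/(well_founded_ind (wo_wf (chain_wo X))): x => x IH.
    by split; case=> [y /IH|c []|f []|[]|[]|[]].
  have ac c : Acc symbol_lt (SConst c).
    elim/(well_founded_ind (wo_wf (const_wo L))): c => c IH.
    by split; case=> [y _|d /IH|f []|[]|[]|[]].
  have af f : Acc symbol_lt (SFunc f).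
    elim/(well_founded_ind (wo_wf (func_wo L))): f => f IH.
    by split; case=> [y _|d _|g /IH|[]|[]|[]].
  have al : Acc symbol_lt SLeft.
    by split; case=> [y _|d _|g _|[]|[]|[]].
  have am : Acc symbol_lt SComma.
    by split; case=> [y _|d _|g _|_|[]|[]].
  have ar : Acc symbol_lt SRight.
    by split; case=> [y _|d _|g _|_|_|[]].
  by case.
Qed.

Section Lex.
Context (T : Type) (lt : T -> T -> Prop) (wo : well_ordering lt).

Lemma lex_trans u v w : lex lt u v -> lex lt v w -> lex lt u w.
Proof.
elim: u v w => [|x u IH] [|y v] [|z w] //= [xy|[-> uv]] [yz|[<- vw]].
- by left; exact: wo_trans yz.
- by left.
- by left.
- by right; split=> //; exact: IH vw.
Qed.

Lemma lex_total u v : lex lt u v \/ u = v \/ lex lt v u.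
Proof.
elim: u v => [|x u IH] [|y v] /=; [by right; left|by left|by right; right|].
have [xy|[->|yx]] := wo_total wo x y; [by left; left| |by right; right; left].
by have [uv|[->|vu]] := IH v;
  [left; right|right; left|right; right; right].
Qed.

Lemma lex_least n (P : set (seq T)) u : P u ->
  (forall v, P v -> size v = n) -> exists v, least (lex lt) P v.
Proof.
elim: n P u => [|n IH] P u Pu Pn.
  by exists u; split=> // v _; rewrite (size0nil (Pn _ Pu)); case: v => [|? ?] [].
have [x0 [v0 Pv0]] : exists x v, P (x :: v).
  by case: u Pu (Pn _ Pu) => // x v; exists x, v.
have [|x [[v1 Pv1] xmin]] := @ex_least _ _ wo [set x | exists v, P (x :: v)] x0.
  by exists v0.
have [| |v [Pv vmin]] := IH [set v | P (x :: v)] v1 => //.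
  by move=> w /Pn [].
exists (x :: v); split=> // -[|y w] Pw; first by have := Pn _ Pw.
by case=> [|[yx]]; [apply: xmin; exists w|apply: vmin; rewrite /= -yx].
Qed.

End Lex.

Lemma eq_comma_sep Y n (g h : 'I_n -> seq (symbol L Y)) :
  forall s : seq 'I_n, (forall i, size (g i) = size (h i)) ->
  size (comma_sep [seq g i | i <- s]) = size (comma_sep [seq h i | i <- s]).
Proof.
move=> s gh; elim: s => [//|i [|j s] IH] /=; first exact: gh.
by rewrite !size_cat gh /=; congr (_ + _.+1).
Qed.

Lemma length_shape t : term_length (shape t) = term_length t.
Proof.
rewrite /term_length; elim: t => //= f a IH; rewrite !size_rcons.
by congr (_.+3); apply: eq_comma_sep.
Qed.

Lemma comma_sep_inj Y (n : nat) (s : seq 'I_n) (a b : 'I_n -> term L Y) u v :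
  (forall i r (w w' : seq (symbol L Y)), term_string (a i) ++ w =
     term_string r ++ w' -> a i = r /\ w = w') ->
  comma_sep [seq term_string (a i) | i <- s] ++ u =
  comma_sep [seq term_string (b i) | i <- s] ++ v ->
  (forall i, i \in s -> a i = b i) /\ u = v.
Proof.
move=> h; elim: s => [//|i [|j s] IH].
  by move=> /= /h [ab ->]; split=> // k; rewrite inE => /eqP ->.
rewrite /= -!catA => /h [ab [/IH [abs ->]]]; split=> // k.
by rewrite inE => /orP [/eqP ->|/abs].
Qed.

Lemma term_string_cat Y (s t : term L Y) u v :
  term_string s ++ u = term_string t ++ v -> s = t /\ u = v.
Proof.
elim: s t u v => [x|c|f a IH] [y|d|g b] u v //=; try by case=> -> ->.
case=> fg; case: _ / fg b => b; rewrite !cat_rcons.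
move=> /(comma_sep_inj IH) [ab [->]]; split=> //; congr App.
by apply/funext => i; apply: ab; rewrite mem_enum.
Qed.

Lemma term_string_inj Y : injective (@term_string Y).
Proof.
move=> s t st; apply: (proj1 (@term_string_cat _ s t [::] [::] _)).
by rewrite st.
Qed.

Lemma neat_wo : well_ordering neat_lt.
Proof.
have lx := lex_trans symbol_wo; split.
- move=> s t r [st|[st1 st2]] [tr|[tr1 tr2]].
  + by left; exact: ltn_trans tr.
  + by left; rewrite -tr1.
  + by left; rewrite st1.
  right; split; first by rewrite st1.
  case: st2 tr2 => [st|[st st']] [tr|[tr tr']].
  + by left; exact: lx tr.
  + by left; rewrite -tr.
  + by left; rewrite st.
  + by right; split; [rewrite st|exact: lx tr'].
- move=> s t.
  have [st|ts|st] := ltngtP (term_length s) (term_length t);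
    [by left; left|by right; right; left|].
  have [h|[h|h]] := lex_total symbol_wo (term_string (shape s))
    (term_string (shape t)); [by left; right; split; [|left]| |
    by right; right; right; split; [|left]].
  have /term_string_inj hs := h.
  have [k|[k|k]] := lex_total symbol_wo (term_string s) (term_string t).
  + by left; right; split=> //; right.
  + by right; left; exact: term_string_inj.
  + by right; right; right; split=> //; right.
- apply: wf_least => P t Pt.
  have ex : exists n, `[< exists2 s, P s & term_length s = n >].
    by exists (term_length t); apply/asboolP; exists t.
  case: (ex_minnP ex) => n /asboolP [s0 Ps0 s0n] nmin.
  pose P1 := [set s | P s /\ term_length s = n].
  have [| |w [[s1 [Ps1 s1n] <-] wmin]] := @lex_least _ _ symbol_wo n
    [set term_string (shape s) | s in P1] (term_string (shape s0)).
  + by exists s0.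
  + by move=> v [s [_ sn] <-]; rewrite -[LHS]/(term_length (shape s)) length_shape.
  pose P2 := [set s | P1 s /\ shape s = shape s1].
  have [| |w2 [[s2 [[Ps2 s2n] s21] <-] vmin]] := @lex_least _ _ symbol_wo n
    [set term_string s | s in P2] (term_string s1).
  + by exists s1.
  + by move=> v [s [[_ sn] _] <-].
  exists s2; split=> // s Ps [lt|[eqn [lt|[eqs lt]]]].
  + have : n <= term_length s by apply: nmin; apply/asboolP; exists s.
    by rewrite -s2n leqNgt lt.
  + apply: (wmin (term_string (shape s))); last by rewrite -s21.
    by exists s => //; split=> //; rewrite eqn.
  + apply: (vmin (term_string s)) => //; exists s => //.
    by split; [split=> //; rewrite eqn|rewrite eqs].
Qed.

End Strings.

Section FreeAlgebra.
Context (L : language) (V : variety L) (X : chain).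

Definition Theta (s t : term L X) : bool :=
  `[< forall A : algebra L, V A -> satisfies A s t >].

Lemma Theta_refl : reflexive Theta.
Proof. by move=> t; apply/asboolP. Qed.

Lemma Theta_sym : symmetric Theta.
Proof. by move=> s t; apply/asbool_equiv_eq; split=> h A VA e; rewrite h. Qed.

Lemma Theta_trans : transitive Theta.
Proof.
move=> t s r /asboolP st /asboolP tr; apply/asboolP => A VA e.
by rewrite (st A VA) (tr A VA).
Qed.

Canonical Theta_equiv := EquivRel Theta Theta_refl Theta_sym Theta_trans.

Definition free_sort := {eq_quot Theta}.

Definition nu (t : term L X) : free_sort := \pi_free_sort t.

Definition free_algebra : algebra L := @Algebra L free_sort
  (inhabits (nu (Var (chain_min X))))
  (fun c => nu (Cst c))
  (fun f a => nu (App (fun i => repr (a i)))).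

Lemma nuP s t : nu s = nu t <-> forall A : algebra L, V A -> satisfies A s t.
Proof. by split=> [/eqquotP/asboolP|h] //; apply/eqquotP/asboolP. Qed.

Lemma nu_App f (a : 'I_(arity f) -> term L X) :
  nu (App a) = alg_func (a := free_algebra) (fun i => nu (a i)).
Proof.
apply/nuP => A VA e /=; congr alg_func; apply/funext => i.
by have /nuP -> : nu (a i) = nu (repr (nu (a i))) by rewrite /nu reprK.
Qed.

Lemma eval_free Y (g : Y -> term L X) (t : term L Y) :
  eval (A := free_algebra) (fun y => nu (g y)) t = nu (subst g t).
Proof.
elim: t => // f a /funext IH; rewrite [subst _ _]/= nu_App -IH.
by [].
Qed.

Lemma free_algebra_in_variety : V free_algebra.
Proof.
have [E VE] := varietyP V; apply/VE => p Ep e.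
have -> : e = (fun y => nu (repr (e y))) by apply/funext => y; rewrite /nu reprK.
rewrite !eval_free; apply/nuP => A VA e'; rewrite !eval_subst.
by have /VE/(_ p Ep) := VA; exact.
Qed.

(* Classes are compared by their neat-least elements; see [nu_rigid]. *)
Definition free_lt (c d : free_algebra) : Prop :=
  exists s t, [/\ least (@neat_lt L X) (nu @^-1` [set c]) s,
    least (@neat_lt L X) (nu @^-1` [set d]) t & neat_lt s t].

Lemma ex_least_nu c : exists s, least (@neat_lt L X) (nu @^-1` [set c]) s.
Proof. by apply: (ex_least (neat_wo L X) (x := repr c)); rewrite /nu /= reprK. Qed.

Lemma nu_rigid : rigid_surjection (@neat_lt L X) free_lt nu.
Proof.
split=> [c|c d s t [s' [t' [hs ht st]]] hs' ht'].
  by exists (repr c); rewrite /nu reprK.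
by rewrite (least_uniq (neat_wo L X) hs' hs) (least_uniq (neat_wo L X) ht' ht).
Qed.

Lemma free_wo : well_ordering free_lt.
Proof.
have wo := neat_wo L X; split.
- move=> a b c [s [t [hs ht st]]] [t' [r [ht' hr tr]]].
  exists s, r; split=> //; apply: (wo_trans wo st).
  by rewrite (least_uniq wo ht ht').
- move=> c d; have [s hs] := ex_least_nu c; have [t ht] := ex_least_nu d.
  have [st|[st|ts]] := wo_total wo s t.
  + by left; exists s, t.
  + by right; left; rewrite -hs.1 -ht.1 st.
  + by right; right; exists t, s.
- apply: wf_least => P c Pc.
  have [|s [Ps smin]] := @ex_least _ _ wo (nu @^-1` P) (repr c).
    by rewrite /nu /= reprK.
  exists (nu s); split=> // d Pd [t [s' [[/= td _] [_ s'min] ts']]].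
  apply: (smin t); first by rewrite /= td.
  have [ss'|[->//|s's]] := wo_total wo s s'; last exact: (wo_trans wo ts').
  by case: (s'min s).
Qed.

End FreeAlgebra.

Record object (L : language) (V : variety L) := Object {
  obj_alg :> algebra L;
  obj_in_variety : V obj_alg;
  obj_lt : obj_alg -> obj_alg -> Prop;
  obj_wo : well_ordering obj_lt
}.

Definition rigid_epimorphism (L : language) (V : variety L) (A B : object V)
    (f : A -> B) : Prop :=
  homomorphism f /\ rigid_surjection (@obj_lt L V A) (@obj_lt L V B) f.

Lemma ltn_wo : well_ordering (fun m n : nat => (m < n)%N).
Proof.
split; first by move=> x y z; exact: ltn_trans.
  by move=> x y; case: ltngtP => h; [left|right; right|right; left].
apply: wf_least => P n Pn.
have ex : exists n, `[< P n >] by exists n; apply/asboolP.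
case: (ex_minnP ex) => m /asboolP Pm mmin; exists m; split=> // k Pk km.
by have := mmin k (asboolT Pk); rewrite leqNgt km.
Qed.

Lemma zero_least : least (fun m n : nat => (m < n)%N) [set: nat] 0%N.
Proof. by []. Qed.

Definition omega : chain := Chain ltn_wo zero_least.

Definition free_object (L : language) (V : variety L) (X : chain) : object V :=
  Object (free_algebra_in_variety V X) (free_wo V X).

Section Degrees.
Context (L : language) (V : variety L).

(* [hom A B] carries the topology induced by the product topology on B^A,
   B being discrete. *)
Definition hom (A B : object V) :
    set {ptws A -> discrete_topology {classic B}} :=
  [set f | rigid_epimorphism f].
Arguments hom : clear implicits.

Lemma hom_comp_subproof (A B C : object V) (f : hom B C) (w : hom A B) :
  (val f \o val w : A -> C) \in hom A C.
Proof.
have [[fc ff] fr] := set_mem (valP f); have [[wc wf] wr] := set_mem (valP w).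
apply/mem_set; split; last first.
  by apply: (@rigid_surjection_comp A B C) wr fr; exact: obj_wo.
split=> [c|g a] /=; first by rewrite wc fc.
by rewrite wf ff.
Qed.

Definition hom_comp (A B C : object V) (f : hom B C) (w : hom A B) : hom A C :=
  exist (fun h => h \in hom A C) _ (hom_comp_subproof f w).

Definition borel_coloring (T : topologicalType) (k : nat) (chi : T -> 'I_k) :
    Prop :=
  forall i, <<s open >> (chi @^-1` [set i]).

Definition degree_bound (A S : object V) (n : nat) : Prop :=
  forall k, (2 <= k)%N -> forall chi : hom S A -> 'I_k, borel_coloring chi ->
  exists w : hom S S, range (fun f : hom S A => chi (hom_comp f w)) #<= `I_n.

(* The big dual Ramsey degree of A in S for Borel colorings; [None] is
   infinity. *)
Definition big_dual_ramsey_degree (A S : object V) : option nat :=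
  match pselect (exists n, (0 < n)%N && `[< degree_bound A S n >]) with
  | left ex => Some (ex_minn ex)
  | right _ => None
  end.

End Degrees.
Arguments hom {L V}.

(* Main.v *)
From Pilot Require Import Defs.
From mathcomp Require Import all_boot.
From mathcomp Require Import all_classical.
From mathcomp Require Import topology function_spaces discrete_topology.
From mathcomp Require Import subtype_topology measurable_structure.
Import Pilot.Defs.

(** A rigid epimorphism from the free algebra on omega to A is determined by
    its values on the variables.  The variables are an initial segment of the
    free algebra, and a rigid map meets the elements of its target for the
    first time in increasing order; so these values are a rigid surjection of
    omega onto an initial segment a_0 < ... < a_l of A.  There are |A| possible
    values of l, and it suffices to find one rigid epimorphism w of the free
    algebra onto itself such that the color of f o w depends on l only.

    The neat order is made so that substituting least preimages for variables
    preserves it; hence a rigid surjection of chains of variables induces a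
    rigid map on terms ([rigid_term_map]).  Two facts follow.  Each rigid
    surjection u of omega onto itself induces a rigid epimorphism of the free
    algebra ([rigid_endo]), which will be w.  And whether a rigid surjection
    onto {0, ..., l} extends to a rigid epimorphism onto A is decided by l
    alone ([hat_onto_rigid]), since both rigidity and surjectivity can be read
    off from the terms in l + 1 variables.  So the theorem reduces to the
    Carlson-Simpson dual Ramsey theorem for Borel colorings of the rigid
    surjections of omega onto {0, ..., l} ([borel_ramsey]), applied
    successively for all l < |A|.

    That theorem is proved by peeling off the last letter.  For a coloring Phi
    one finds u such that Phi (g o u) depends only on the part of g that
    precedes its first l.  For a given length n of this part, its finitely many
    values are treated at once: an infinite word whose letters are the n + 1
    first positions is colored by the vector of the colors obtained from all
    of them.  A Borel set is open up to a meager set, so a variable word with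
    only generic instances gives a constant vector, once its initial segment
    forces a value ([baire_left_variable]).  A fusion takes care of all
    n ([fusion]).

    What remains is a coloring of finite words, in which the letters are peeled
    off in the same manner ([finite_ramseyP]); category is then replaced by the
    Carlson-Simpson lemma on left variable words ([carlson_simpson]).  Its
    source is an idempotent ultrafilter on left variable words all of whose
    images under substitution of letters lie in one minimal left ideal of the
    semigroup of ultrafilters on words ([ex_absorbing_ultrafilters]). *)

Set Implicit Arguments.
Unset Strict Implicit.
Unset Printing Implicit Defensive.

Local Open Scope classical_set_scope.
Local Open Scope card_scope.

(** * Filters and ultrafilters *)

Section FilterZorn.
Context (T : Type).
Implicit Types F G : set_system T.

Lemma bigcup_chain_proper (Z : set (set_system T)) :
  Z !=set0 -> total_on Z subset -> (forall F, Z F -> ProperFilter F) ->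
  ProperFilter (\bigcup_(F in Z) F).
Proof.
move=> [F0 ZF0] totZ ZP; apply: Build_ProperFilter_ex.
  by move=> A [F ZF FA]; have PF := ZP _ ZF; exact: filter_ex FA.
split.
- by have PF := ZP _ ZF0; exists F0; [|exact: filterT].
- move=> A B [F ZF FA] [G ZG GB]; have PF := ZP _ ZF; have PG := ZP _ ZG.
  have [FG|GF] := totZ _ _ ZF ZG.
  + by exists G => //; apply: filterI => //; exact: FG.
  + by exists F => //; apply: filterI => //; exact: GF.
- by move=> A B AB [F ZF FA]; have PF := ZP _ ZF; exists F => //;
    exact: filterS FA.
Qed.

(** A filter stands for the closed set of the ultrafilters that contain it, so
    a maximal filter with a property is a minimal closed set with it.  Chains
    need bounds only when nonempty, because [F0] bounds the empty one. *)
Lemma maximal_filter (P : set (set_system T)) F0 :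
  ProperFilter F0 -> P F0 ->
  (forall Z, Z !=set0 -> total_on Z subset ->
     (forall F, Z F -> ProperFilter F /\ P F) -> P (\bigcup_(F in Z) F)) ->
  exists F, [/\ ProperFilter F, P F, F0 `<=` F &
    forall G, ProperFilter G -> P G -> F `<=` G -> G = F].
Proof.
move=> F0P PF0 chainP; pose Q F := [/\ ProperFilter F, P F & F0 `<=` F].
have [Z QZ totZ|F [QF Fmax]] := @Zorn_bigcup _ [set F | F = set0 \/ Q F].
  have [[G [ZG QG]]|nZ] := pselect (exists G, Z G /\ Q G); [right|left];
    last first.
    rewrite -subset0 => A [G ZG GA].
    by have [G0|QG] := QZ _ ZG; [rewrite -G0|case: nZ; exists G].
  have -> : \bigcup_(F in Z) F = \bigcup_(F in Z `&` Q) F.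
    apply/seteqP; split=> A [F]; last by move=> [ZF _]; exists F.
    by move=> ZF FA; exists F => //; split=> //; case: (QZ _ ZF) FA => // ->.
  have tot : total_on (Z `&` Q) subset by move=> F F' [ZF _] [ZF' _];
    exact: totZ.
  have ne : (Z `&` Q) !=set0 by exists G.
  split; [by apply: bigcup_chain_proper => // F [_ []]| |].
  - by apply: chainP => // F [_ []].
  - by move=> A /(let: And3 _ _ h := QG in h) GA; exists G.
have {QF} [F00|[FP PF F0F]] := QF.
  case: (Fmax F0); last by right; split.
  rewrite F00; split=> // /(_ setT); apply; exact: filterT.
exists F; split=> // G GP PG FG; apply: contrapT => nGF.
apply: (Fmax G); last by right; split=> //; exact: subset_trans FG.
by split=> // GF; apply: nGF; apply/seteqP.
Qed.

Lemma proper_nC F A : ProperFilter F -> F A -> ~ F (~` A).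
Proof. by move=> FP FA FCA; have [x []] := filter_ex (filterI FA FCA). Qed.

Lemma ultraP F : ProperFilter F -> (forall A, F A \/ F (~` A)) -> UltraFilter F.
Proof.
move=> FP Fd; split=> // G GP FG; apply/seteqP; split=> // A GA.
have [//|/FG GCA] := Fd A.
by have := proper_nC GP GA GCA.
Qed.

Lemma ultra_max F G : UltraFilter F -> ProperFilter G -> F `<=` G -> G = F.
Proof. by move=> FU GP; exact: max_filter. Qed.

(** Otherwise the complement of [A] is compatible with [F], and an ultrafilter
    that contains both contradicts the hypothesis. *)
Lemma filter_ultraI F A : Filter F ->
  (forall G, UltraFilter G -> F `<=` G -> G A) -> F A.
Proof.
move=> FF h; apply: contrapT => nFA.
have P : ProperFilter [set B | F (A `|` B)].
  apply: Build_ProperFilter_ex.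
    move=> B /= FB; apply: contrapT => /forallNP nB; apply: nFA.
    by apply: filterS FB => x [//|/nB].
  split; first by rewrite /= setUT; exact: filterT.
  - by move=> B C; rewrite /= setUIr; exact: filterI.
  - by move=> B C BC /=; apply: filterS; exact: setUS.
have [G [GU sG]] := ultraFilterLemma P.
have GA : G A.
  by apply: h => // B FB; apply: sG => /=; apply: filterS FB => x; right.
have GCA : G (~` A) by apply: sG; rewrite /= setUCr; exact: filterT.
by have := proper_nC (ultra_proper (UltraFilter := GU)) GA GCA.
Qed.

Lemma ultra_not F A : UltraFilter F -> ~ F A -> F (~` A).
Proof. by move=> FU; have [] := in_ultra_setVsetC A FU. Qed.

End FilterZorn.

(** * The semigroup of ultrafilters on a semigroup *)

Section Convolution.
Context (S : Type) (op : S -> S -> S) (opA : associative op).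
Implicit Types p q r H : set_system S.

(** The extension of [op] to ultrafilters, continuous in its first argument. *)
Definition conv p q : set_system S := [set C | p [set w | q (op w @^-1` C)]].

Lemma convA p q r : conv (conv p q) r = conv p (conv q r).
Proof.
apply/funext => C; rewrite /conv /=; congr p; apply/funext => u /=.
congr q; apply/funext => v /=; congr r; apply/funext => w /=.
by rewrite /preimage /= opA.
Qed.

Lemma conv_proper p q : ProperFilter p -> ProperFilter q ->
  ProperFilter (conv p q).
Proof.
move=> pP qP; apply: Build_ProperFilter_ex.
  move=> C pC; have [w qw] := @filter_ex _ p _ _ pC.
  by have [v Cv] := filter_ex qw; exists (op w v).
split.
- by apply: (@filterS _ p _ setT) => [w _ /=|]; exact: filterT.
- move=> C D pC pD; rewrite /conv /=.
  by apply: (@filterS _ p) (@filterI _ p _ _ _ pC pD) => w [qC qD];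
    exact: filterI.
- by move=> C D CD; rewrite /conv /=; apply: filterS => w; apply: filterS => v;
    exact: CD.
Qed.

Lemma conv_ultra p q : UltraFilter p -> UltraFilter q -> UltraFilter (conv p q).
Proof.
move=> pU qU; apply: ultraP => [|C]; first exact: conv_proper.
have [|nC] := pselect (conv p q C); [by left|right].
by apply: filterS (ultra_not pU nC) => w /=; exact: ultra_not.
Qed.

Lemma conv_subl p p' q : p `<=` p' -> conv p q `<=` conv p' q.
Proof. by move=> pp' C; exact: pp'. Qed.

(** The filter of the closed set of the ultrafilters [g] containing [H] such
    that [conv g q = f]; see [fiber_conv] and [sub_fiber]. *)
Definition fiber H q f : set_system S :=
  [set D | exists E C, [/\ H E, f C & E `&` [set v | q (op v @^-1` C)] `<=` D]].

Lemma fiber_filter H q f : Filter H -> Filter q -> Filter f ->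
  Filter (fiber H q f).
Proof.
move=> HF qF fF; split.
- by exists setT, setT; split=> //; exact: filterT.
- move=> D D' [E [C [HE fC sD]]] [E' [C' [HE' fC' sD']]].
  exists (E `&` E'), (C `&` C'); split; [exact: filterI|exact: filterI|].
  move=> v [[Ev E'v] /= qv]; split; [apply: sD|apply: sD']; split=> //=.
  + by apply: filterS qv => w [].
  + by apply: filterS qv => w [].
- by move=> D D' DD' [E [C [HE fC sD]]]; exists E, C; split=> [||v /sD /DD'].
Qed.

Lemma fiber_sub H q f : Filter f -> H `<=` fiber H q f.
Proof. by move=> fF D HD; exists D, setT; split=> [//||v []//];
  exact: filterT. Qed.

Lemma fiber_conv H q f g : Filter H -> fiber H q f `<=` g -> f `<=` conv g q.
Proof.
by move=> HF sg C fC; apply: sg; exists setT, C; split=> [|//|v []//];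
  exact: filterT.
Qed.

Lemma sub_fiber H q f g : Filter g -> H `<=` g -> f `<=` conv g q ->
  fiber H q f `<=` g.
Proof.
move=> gF Hg fg D [E [C [/Hg gE /fg gC sD]]].
by apply: filterS sD _; exact: filterI.
Qed.

(** Right convolution by [q] maps closed sets onto closed sets, by compactness:
    an element [f] of the closure of the image has a nonempty fiber. *)
Lemma conv_factor H q f : ProperFilter H -> UltraFilter q -> UltraFilter f ->
  conv H q `<=` f -> exists g, [/\ UltraFilter g, H `<=` g & conv g q = f].
Proof.
move=> HP qU fU sf.
have P : ProperFilter (fiber H q f).
  split; last exact: fiber_filter.
  move=> [E [C [HE fC s0]]].
  apply: (proper_nC _ fC); apply: sf; apply: filterS HE => v Ev /=.
  by apply: ultra_not => qv; exact: (s0 v).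
have [g [gU sg]] := ultraFilterLemma P; exists g; split=> //.
  by apply: subset_trans sg; exact: fiber_sub.
by apply: ultra_max => //; [exact: conv_proper|exact: fiber_conv sg].
Qed.

(** The closed set represented by [H] is a subsemigroup. *)
Definition sub_semigroup H : Prop :=
  forall f g, UltraFilter f -> UltraFilter g -> H `<=` f -> H `<=` g ->
    H `<=` conv f g.

(** Ellis' argument: in a minimal closed subsemigroup [H], both [H q] and the
    elements that fix [q] on the left form closed subsemigroups, hence are all
    of [H], and so [q] fixes itself. *)
Lemma ex_idempotent H0 : ProperFilter H0 -> sub_semigroup H0 ->
  exists f, [/\ UltraFilter f, H0 `<=` f & conv f f = f].
Proof.
move=> H0P H0s.
have [|H [HP Hs H0H Hmax]] := @maximal_filter S sub_semigroup H0 H0P H0s.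
  move=> Z _ _ ZP f g fU gU Zf Zg C [F ZF FC]; have [_ Fs] := ZP _ ZF.
  by apply: (Fs f g) => // D FD; [apply: Zf|apply: Zg]; exists F.
have [q [qU Hq]] := ultraFilterLemma HP.
have Hconv : conv H q = H.
  apply: Hmax; first exact: conv_proper.
  - move=> f g fU gU /(conv_factor HP qU fU) [f0 [f0U Hf0 <-]].
    move=> /(conv_factor HP qU gU) [g0 [g0U Hg0 <-]].
    rewrite -convA; apply: conv_subl; apply: (Hs) => //.
      exact: conv_ultra.
    exact: Hs.
  - move=> C HC; rewrite /conv /=; apply: (@filter_ultraI _ H) => f fU Hf.
    exact: (Hs f q).
have [g [gU Hg gq]] : exists g, [/\ UltraFilter g, H `<=` g & conv g q = q].
  by apply: (conv_factor HP qU qU); rewrite Hconv.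
have fq f : UltraFilter f -> fiber H q q `<=` f -> conv f q = q.
  move=> fU sf; apply: ultra_max; first exact: conv_proper.
  exact: fiber_conv sf.
have Hfib : fiber H q q = H.
  apply: Hmax; last exact: fiber_sub.
  - split; last exact: fiber_filter.
    have : fiber H q q `<=` g by apply: sub_fiber => //; rewrite gq.
    by move=> /[apply]; exact: filter_not_empty.
  - move=> f f' fU f'U sf sf'; have ff'U := conv_ultra fU f'U; apply: sub_fiber.
    + by apply: Hs => //; [apply: subset_trans sf|apply: subset_trans sf'];
        exact: fiber_sub.
    + by rewrite convA !fq.
by exists q; split=> //; [exact: subset_trans Hq|apply: fq; rewrite ?Hfib].
Qed.

(** The closed set represented by [H] is a left ideal. *)
Definition left_invariant H : Prop :=
  forall s C, H C -> H (op s @^-1` C).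

Lemma ex_maximal_left_invariant (s0 : S) : exists F, [/\ ProperFilter F,
  left_invariant F & forall G, ProperFilter G -> left_invariant G ->
    F `<=` G -> G = F].
Proof.
pose F0 : set_system S := [set setT].
have F0P : ProperFilter F0 by apply: Build_ProperFilter_ex => _ ->; exists s0.
have [| |F [FP Fi _ Fmax]] := @maximal_filter S left_invariant F0 F0P.
- by move=> s C ->.
- by move=> Z _ _ ZP s C [F ZF FC]; exists F => //; apply: (ZP _ ZF).2.
- by exists F.
Qed.

(** In a minimal left ideal, each idempotent [u] is a right identity.  The
    filter of the left ideal generated by [u] is [G] below, and equals [F] by
    minimality.  Were [p u] different from [p], the set [B] of the [w] in some
    [C] with [w^-1 C] outside [u] would be in [p].  But the complement of [B] is
    in [G]: if [s^-1 B] were in [u = u u], then for some [s v] in [B] also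
    [(s v)^-1 B], and hence [(s v)^-1 C], would be in [u]. *)
Lemma right_identity F u p : ProperFilter F -> left_invariant F ->
  (forall G, ProperFilter G -> left_invariant G -> F `<=` G -> G = F) ->
  UltraFilter u -> F `<=` u -> conv u u = u ->
  UltraFilter p -> F `<=` p -> conv p u = p.
Proof.
move=> FP Fi Fmax uU Fu uu pU Fp.
pose G : set_system S := [set C | forall s, u (op s @^-1` C)].
have FG : F = G.
  symmetry; apply: Fmax.
  - apply: Build_ProperFilter_ex.
      have [s _] := filter_ex (@filterT _ F _).
      by move=> C /(_ s) Cs; have [v Cv] := filter_ex Cs; exists (op s v).
    split; first by move=> s; exact: filterT.
    + by move=> A B GA GB s; exact: filterI (GA s) (GB s).
    + by move=> A B AB GA s; apply: filterS (GA s) => v; exact: AB.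
  - move=> s C GC t; apply: filterS (GC (op s t)) => v /=.
    by rewrite /preimage /= opA.
  - by move=> C FC s; apply: Fu; exact: Fi.
apply: ultra_max; first exact: conv_proper.
move=> C pC; apply: contrapT => nC.
pose B := C `&` [set w | ~ u (op w @^-1` C)].
have pB : p B by apply: filterI => //;
  exact: (ultra_not (A := [set w | u (op w @^-1` C)]) pU nC).
apply: (proper_nC _ pB); apply: Fp; rewrite FG => s;
  apply: (ultra_not (A := op s @^-1` B) uU) => usB.
have := usB; rewrite -[X in X _]uu => uusB.
have [v [[_ nu] /= uv]] := filter_ex (filterI usB uusB).
apply: nu; apply: filterS uv => v' /=.
by rewrite /preimage /= opA => -[].
Qed.

End Convolution.

(** [L] is a semigroup of variable words, [h b] the substitution of [b] for the
    variable, and [act] appends a constant word.  The images of [f] under the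
    [h b] are idempotents of one minimal left ideal, hence right identities for
    each other: the image under [h a] absorbs the image under [h b].  A
    variable word followed by a suitable constant word has all its instances in
    a given member of the filter of this ideal, so that candidates for [f]
    exist. *)
Lemma ex_absorbing_ultrafilters (B : finType) (S L : Type)
    (opS : S -> S -> S) (opL : L -> L -> L) (act : L -> S -> L)
    (h : B -> L -> S) (l0 : L) :
  associative opS -> associative opL ->
  (forall b l l', h b (opL l l') = opS (h b l) (h b l')) ->
  (forall b l s, h b (act l s) = opS (h b l) s) ->
  B -> exists2 f : set_system L, UltraFilter f &
    forall a b C, f (h a @^-1` C) ->
      f [set l | f [set l' | C (opS (h a l) (h b l'))]].
Proof.
move=> SA LA hM hact b0.
have [F [FP Fi Fmax]] := ex_maximal_left_invariant opS (h b0 l0).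
(* The closed set of the ultrafilters all of whose images are in the ideal. *)
pose H0 : set_system L := [set D | exists2 C, F C &
  [set l | forall b, C (h b l)] `<=` D].
have H0P : ProperFilter H0.
  apply: Build_ProperFilter_ex.
    move=> D [C FC sD].
    have : \forall s \near F, forall b, C (opS (h b l0) s).
      by apply: filter_forall => b; exact: Fi.
    move=> FCs; have [s Cs] := filter_ex FCs; by exists (act l0 s);
      apply: sD => b; rewrite hact.
  split.
  - by exists setT => //; exact: filterT.
  - move=> D D' [C FC sD] [C' FC' sD']; exists (C `&` C'); first exact: filterI.
    by move=> l hl; split; [apply: sD|apply: sD'] => b; have [] := hl b.
  - by move=> D D' DD' [C FC sD]; exists C => [|l /sD /DD'].
have H0s : sub_semigroup opL H0.
  move=> f g fU gU sf sg D [C FC sD].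
  apply: (@filterS _ f _ setT) => [v _|]; last exact: filterT.
  have gC : g [set l | forall b, C (opS (h b v) (h b l))].
    apply: sg; exists [set s | forall b, C (opS (h b v) s)] => [|l hl b].
      by apply: (@filter_forall _ _ _ F) => b; exact: Fi.
    exact: (hl b b).
  by apply: (@filterS _ g _ _ _ _ gC) => l hl; apply: sD => b; rewrite hM.
have [f [fU sf ff]] := ex_idempotent LA H0P H0s.
exists f => // a b C faC.
pose u c : set_system S := [set D | f (h c @^-1` D)].
have uU c : UltraFilter (u c).
  by apply: ultraP => D; exact: (in_ultra_setVsetC (h c @^-1` D) fU).
have Fu c : F `<=` u c.
  by move=> D FD; apply: sf; exists D => // l /(_ c).
have uu c : conv opS (u c) (u c) = u c.
  apply: ultra_max => //; first exact: conv_proper.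
  move=> D ucD; have ffD : conv opL f f (h c @^-1` D) by rewrite ff.
  apply: (@filterS _ f _ _ _ _ ffD) => l flD;
    apply: (@filterS _ f _ _ _ _ flD) => l'.
  by rewrite /preimage /= hM.
have uaC : u a C by [].
by rewrite -(right_identity SA FP Fi Fmax (uU b) (Fu b) (uu b) (uU a) (Fu a)) in
  uaC.
Qed.

(** * Left variable words and the Carlson-Simpson lemma *)

Section LeftVariableWords.
Context (B : finType).

(** A left variable word starts with the variable; [t] is what follows, with
    [None] for the further occurrences of the variable. *)
Definition plug (b : B) (t : seq (option B)) : seq B := b :: map (odflt b) t.

Fixpoint inst (w0 : seq B) (t : nat -> seq (option B)) (b : nat -> B) (n :
  nat) :
    seq B :=
  if n is n'.+1 then inst w0 t b n' ++ plug (b n') (t n') else w0.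

(** The words [t] are chosen one after the other, each of them good for the
    finitely many instances of the preceding ones. *)
Lemma ex_left_variable_words (G : nat -> set (seq B)) w0 : G 0 w0 ->
  (forall i (ws : seq (seq B)), (forall w, w \in ws -> G i w) ->
    exists t, forall w b, w \in ws -> G i.+1 (w ++ plug b t)) ->
  exists t, forall n b, G n (inst w0 t b n).
Proof.
move=> G0 step.
have {step} : forall iws : nat * seq (seq B), exists t,
    (forall w, w \in iws.2 -> G iws.1 w) ->
    forall w b, w \in iws.2 -> G iws.1.+1 (w ++ plug b t).
  move=> [i ws] /=; have [/step[t ht]|n] :=
    pselect (forall w, w \in ws -> G i w).
    by exists t.
  by exists [::].
move=> /choice[tau htau].
pose level := fix level n := if n is n'.+1 then
  [seq w ++ plug b (tau (n', level n')) | w <- level n', b <- enum B] else [::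
    w0].
have Glevel n : forall w, w \in level n -> G n w.
  elim: n => [|n IH] w; first by rewrite inE => /eqP ->.
  by case/allpairsP=> -[w' b] /= [w'l _ ->]; exact: (htau (n, level n)).
exists (fun n => tau (n, level n)) => n b; apply: Glevel.
elim: n => [|n IH]; first by rewrite inE.
by apply/allpairsP; exists (inst w0 (fun n => tau (n, level n)) b n, b n);
  rewrite mem_enum.
Qed.

(** Let [C] be a color class that is large for the absorbing ultrafilter [f]
    after substitution of some letter.  A word [w] in [C] is in [star] if [f]
    almost every [l] keeps it in [C], whatever letter is substituted.
    Absorption says that [f] almost every [l] even keeps it in [star], so a
    construction started in [star] never stops. *)
Lemma carlson_simpson (K : finType) (c : seq B -> K) : B ->
  exists w0 t k, forall b n, c (inst w0 t b n) = k.
Proof.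
move=> b0.
(* Concatenation of left variable words with the same variable. *)
pose op t t' : seq (option B) := t ++ None :: t'.
have opA : associative op by move=> t t' t''; rewrite /op -catA.
have [| |f fU fabs] := @ex_absorbing_ultrafilters B _ _ cat op
    (fun l s => l ++ map Some s) plug [::] (@catA B) opA _ _ b0.
- by move=> b l l'; rewrite /plug map_cat.
- move=> b l s; rewrite /plug map_cat -map_comp.
  by rewrite (_ : map (_ \o Some) s = s) // map_id.
have [k fk] : exists k, f (plug b0 @^-1` (c @^-1` [set k])).
  apply: contrapT => /forallNP nf.
  have : \forall l \near f, forall k, ~ c (plug b0 l) = k.
    by apply: (filter_forall (F := f)) => k; exact: ultra_not (nf k).
  move=> fn; have [l /(_ (c (plug b0 l)))] := @filter_ex _ f _ _ fn.
  exact.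
pose C := c @^-1` [set k].
pose star : set (seq B) :=
  [set w | C w /\ forall b, f [set l | C (w ++ plug b l)]].
have [l0 sl0] : exists l, star (plug b0 l).
  apply: (@filter_ex _ f); apply: filterI => //.
  by apply: (filter_forall (F := f)) => b; exact: fabs.
have [||t ht] := @ex_left_variable_words (fun=> star) (plug b0 l0) => //;
  last first.
  by exists (plug b0 l0), t, k => b n; have [] := ht n b.
move=> _ ws wsC.
have : \forall l \near f, forall (w : seq_sub ws) b, star (val w ++ plug b l).
  apply: (filter_forall (F := f)) => w; apply: (filter_forall (F := f)) => b.
  have [_ /(_ b) fw] := wsC _ (valP w).
  apply: filterI => //; apply: (filter_forall (F := f)) => b'.
  have := fabs b b' [set v | C (val w ++ v)] fw.
  apply: (@filterS _ f) => l fl; apply: (@filterS _ f _ _ _ _ fl) => l'.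
  by rewrite /= -catA.
move=> fs; have [l hl] := @filter_ex _ f _ _ fs.
by exists l => w b wws; exact: (hl (SeqSub wws)).
Qed.

End LeftVariableWords.

(** * Rigid surjections of omega *)

(** Asking for smaller letters before [p], and not just for other letters, makes
    the first occurrences of several letters increase, so that [rigid] and
    [upto] need nothing else. *)
Definition first (g : nat -> nat) (n p : nat) : Prop :=
  g p = n /\ forall i, i < p -> g i < n.

Definition rigid (g : nat -> nat) : Prop := forall n, exists p, first g n p.

(** Letters above [l] are unrestricted, apart from occurring after the first
    [l]. *)
Definition upto (l : nat) (g : nat -> nat) : Prop :=
  forall n, n <= l -> exists p, first g n p.

Lemma first_uniq g n p q : first g n p -> first g n q -> p = q.
Proof.
move=> [gp hp] [gq hq]; case: (ltngtP p q) => // [/hq|/hp].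
  by rewrite gp ltnn.
by rewrite gq ltnn.
Qed.

Lemma first_lt g m n p q : first g m p -> first g n q -> m < n -> p < q.
Proof.
move=> [gp hp] [gq hq] mn; case: (ltngtP p q) => // [/hp|pq].
  by rewrite gq => /(ltn_trans mn); rewrite ltnn.
by move: mn; rewrite -gp -gq pq ltnn.
Qed.

Lemma first_comp g u n p q : first g n p -> first u p q -> first (g \o u) n q.
Proof.
move=> [gp hp] [uq hq]; split; first by rewrite /= uq.
by move=> i /hq /hp.
Qed.

Lemma upto_comp l g u : upto l g -> rigid u -> upto l (g \o u).
Proof.
move=> gl ru n /gl [p gp]; have [q uq] := ru p.
by exists q; exact: first_comp uq.
Qed.

Lemma rigid_comp g u : rigid g -> rigid u -> rigid (g \o u).
Proof. by move=> rg ru n; apply: (@upto_comp n) (leqnn n) => // m _. Qed.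

Lemma rigid_id : rigid id.
Proof. by move=> n; exists n. Qed.

Lemma rigid_le u i : rigid u -> u i <= i.
Proof.
move=> ru.
have le n p : first u n p -> n <= p.
  elim: n p => // n IH p up; have [q uq] := ru n.
  exact: leq_ltn_trans (IH _ uq) (first_lt uq up _).
have [p up] := ru (u i); apply: leq_trans (le _ _ up) _.
by rewrite leqNgt; apply/negP => /up.2; rewrite ltnn.
Qed.

(** * Parameter words as rigid surjections *)

Section ParameterWord.
Context (n : nat) (w0 : seq 'I_n.+1) (t : nat -> seq (option 'I_n.+1)).

(** The concatenation of [0 ... n], of [w0] and of left variable words with the
    distinct variables [n + 1], [n + 2], ...; the letters [0 ... n] are the
    constants. *)
Fixpoint pword_pre (i : nat) : seq nat :=
  if i is i'.+1 then
    pword_pre i' ++ (n.+1 + i') :: map (oapp val (n.+1 + i')) (t i')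
  else iota 0 n.+1 ++ map val w0.

Definition pword (q : nat) : nat := nth 0 (pword_pre q) q.

(** Substitution of letters for the variables of [pword]. *)
Definition assign (b : nat -> 'I_n.+1) (x : nat) : nat :=
  if x <= n then x else b (x - n.+1).

Lemma size_pword_pre i : n.+1 + i <= size (pword_pre i).
Proof.
elim: i => [|i IH]; first by rewrite addn0 size_cat size_iota leq_addr.
rewrite /= size_cat /= !addnS ltnS; apply: leq_trans IH _.
exact: leq_addr.
Qed.

Lemma pword_pre_prefix i j : i <= j -> exists s, pword_pre j = pword_pre i ++ s.
Proof.
move=> /subnKC <-; elim: (j - i) => [|k [s IH]].
  by exists [::]; rewrite addn0 cats0.
by rewrite addnS /= IH; eexists; rewrite -catA.
Qed.

Lemma pword_nth i q : q < size (pword_pre i) -> pword q = nth 0 (pword_pre i) q.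
Proof.
move=> qi; rewrite /pword;
  case/orP: (leq_total i q) => /pword_pre_prefix [s ->].
  by rewrite nth_cat qi.
by rewrite nth_cat (leq_trans _ (size_pword_pre q)) // addSn ltnS leq_addl.
Qed.

Lemma mem_pword_pre i x : x \in pword_pre i -> x < n.+1 + i.
Proof.
elim: i => [|i IH].
  rewrite addn0 /pword_pre mem_cat mem_iota add0n => /orP[//|/mapP[y _ ->]].
  exact: ltn_ord.
rewrite mem_cat inE addnS => /orP[/IH /ltnW //|/orP[/eqP ->|]];
  first exact: ltnSn.
case/mapP=> -[y|] _ -> /=; last exact: ltnSn.
by apply: (leq_trans (ltn_ord y)); rewrite -addnS leq_addr.
Qed.

Lemma pword_le q : q <= n -> pword q = q.
Proof.
move=> qn; rewrite (@pword_nth 0); last by apply: leq_trans (size_pword_pre 0);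
  rewrite addn0.
by rewrite nth_cat size_iota ltnS qn nth_iota.
Qed.

Lemma first_pword i : first pword (n.+1 + i) (size (pword_pre i)).
Proof.
split; first by rewrite (@pword_nth i.+1) /= ?nth_cat ?ltnn ?subnn // size_cat
  /= addnS ltnS leq_addr.
by move=> q qi; rewrite (pword_nth qi); apply: mem_pword_pre; exact: mem_nth.
Qed.

Lemma rigid_pword : rigid pword.
Proof.
move=> m; case: (leqP m n) => [mn|/subnKC <-]; last by eexists;
  exact: first_pword.
exists m; split=> [|i im]; first exact: pword_le.
by rewrite pword_le // (leq_trans _ mn) // ltnW.
Qed.

Lemma assign_pword_pre b i :
  map (assign b) (pword_pre i) = iota 0 n.+1 ++ map val (inst w0 t b i).
Proof.
have bE (y : 'I_n.+1) : assign b y = y by rewrite /assign -ltnS ltn_ord.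
elim: i => [|i IH].
  rewrite map_cat; congr cat.
    by rewrite -[RHS]map_id; apply/eq_in_map => x;
      rewrite mem_iota /assign add0n ltnS => /andP[_ ->].
  by rewrite -map_comp; apply: eq_map => y; rewrite /= bE.
have biE : assign b (n.+1 + i) = b i.
  by rewrite /assign addSn leqNgt ltnS leq_addr /= subSS addKn.
rewrite [pword_pre _]/= [inst _ _ _ _]/= map_cat IH map_cat -catA.
congr (_ ++ (_ ++ _)); rewrite /= biE; congr cons; rewrite -!map_comp.
by apply: eq_map => -[y|] /=; rewrite ?bE ?biE.
Qed.

End ParameterWord.

(** * Fusion *)

Section Fusion.
Variable D : nat -> set (nat -> nat).
Hypothesis D_comp : forall n u r, rigid u -> D n u ->
  rigid r -> (forall i, i <= n -> r i = i) -> D n (r \o u).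
Hypothesis D_ex : forall n u, rigid u ->
  exists r, [/\ rigid r, forall i, i <= n -> r i = i & D n (r \o u)].

(** The composites [st n] of successive corrections converge pointwise, because
    the correction at stage [n] fixes the letters up to [n].  The limit is
    [R n \o st n], where [R n], the composite of the corrections after stage
    [n], also fixes these letters; so it inherits [D n] from [st n]. *)
Lemma fusion : exists2 u, rigid u & forall n, D n u.
Proof.
have /choice[rho hrho] : forall nu : nat * (nat -> nat), exists r, rigid nu.2 ->
    [/\ rigid r, forall i, i <= nu.1 -> r i = i & D nu.1 (r \o nu.2)].
  move=> [n u] /=; have [/(D_ex n)[r ?]|nr] := pselect (rigid u);
    first by exists r.
  by exists id.
pose st := fix st n := if n is n'.+1 then rho (n, st n') \o st n' else rho (0,
  id).
pose r n := if n is n'.+1 then rho (n, st n') else rho (0, id).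
have st_rigid n : rigid (st n).
  elim: n => [|n IH]; first by have [] := hrho (0, id) rigid_id.
  by apply: rigid_comp => //; have [] := hrho (n.+1, st n) IH.
have r_rigid n : rigid (r n).
  by case: n => [|n]; [have [] := hrho (0, id) rigid_id|
    have [] := hrho (n.+1, st n) (st_rigid n)].
have r_id n i : i <= n -> r n i = i.
  by case: n => [|n]; [have [_ + _] := hrho (0, id) rigid_id; apply|
    have [_ + _] := hrho (n.+1, st n) (st_rigid n); apply].
have D_st n : D n (st n).
  by case: n => [|n]; [have [] := hrho (0, id) rigid_id|
    have [] := hrho (n.+1, st n) (st_rigid n)].
(* The composite of the [k] corrections that follow stage [n]. *)
pose tail n := fix tail k := if k is k'.+1 then r (n + k) \o tail k' else id.
have tailS n k : tail n k.+1 = r (n + k).+1 \o tail n k by rewrite /= addnS.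
have tail_rigid n k : rigid (tail n k).
  by elim: k => [|k IH]; [exact: rigid_id|exact: rigid_comp].
have st_tail n k : st (n + k) = tail n k \o st n.
  by elim: k => [|k IH]; [rewrite addn0|rewrite addnS tailS -compA -IH].
have tail_stable n k k' x : k <= k' -> tail n k x <= n + k ->
    tail n k' x = tail n k x.
  move=> /subnKC <- xk; elim: (k' - k) => [|j IH]; first by rewrite addn0.
  rewrite addnS tailS -[LHS]/(r _ (tail n _ x)) IH r_id //;
    apply: leq_trans xk _.
  by rewrite addnA leqW // leq_addr.
pose R n x := tail n x x.
have RE n k x : x <= k -> tail n k x = R n x.
  move=> xk; apply: tail_stable => //.
  by apply: leq_trans (rigid_le _ (tail_rigid _ _)) (leq_addl _ _).
have R_rigid n : rigid (R n).
  move=> v; have [p [vp hp]] := tail_rigid n v v; exists p.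
  have RtE i : tail n v i <= v -> R n i = tail n v i.
    move=> iv; rewrite -(RE n (maxn v i)) ?leq_maxr //.
    by apply: tail_stable; rewrite ?leq_maxl // (leq_trans iv) // leq_addl.
  split=> [|i ip]; first by rewrite RtE vp.
  by rewrite RtE; [exact: hp|apply: ltnW; exact: hp].
pose u x := st x x.
have uE n : u = R n \o st n.
  apply/funext => x; rewrite /u /=.
  rewrite -(RE n x); last exact: rigid_le.
  have -> : tail n x (st n x) = st (n + x) x by rewrite st_tail.
  by rewrite addnC st_tail /= (@tail_stable x 0 n) //= addn0 rigid_le.
exists u; first by rewrite (uE 0); exact: rigid_comp.
move=> n; rewrite (uE n); apply: D_comp => // i ni.
by rewrite /R (@tail_stable n 0 i) // addn0.
Qed.

End Fusion.

(** * The dual Ramsey theorem for colorings of finite words *)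

(** A surjective rigid word over [0 ... l - 1] is given as the part of a rigid
    [g] before its first [l]. *)
Definition finite_ramsey (l : nat) : Prop :=
  forall (K : finType) (c : seq nat -> K), exists2 u, rigid u &
    exists k, forall g q, upto l g -> first (g \o u) l q ->
      c (mkseq (g \o u) q) = k.

Definition prefix_determined (K : Type) (G : set (nat -> nat))
    (Phi : (nat -> nat) -> K) (l n : nat) (u : nat -> nat) : Prop :=
  forall h h', G h -> G h' -> first h l n -> first h' l n ->
    (forall i, i < n -> h i = h' i) -> Phi (h \o u) = Phi (h' \o u).

(** Fusion makes the color of [g] a function of the part of [g] before its
    first [l], for all lengths of this part at once, and the theorem for finite
    words over [l] letters makes that function constant. *)
Lemma ramsey_step (K : finType) (G : set (nat -> nat))
    (Phi : (nat -> nat) -> K) l :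
  finite_ramsey l -> G `<=` upto l ->
  (forall g u, G g -> rigid u -> G (g \o u)) ->
  (forall n u, rigid u -> exists r, [/\ rigid r, forall i, i <= n -> r i = i &
    prefix_determined G Phi l n (r \o u)]) ->
  exists2 u, rigid u & exists k, forall g, G g -> Phi (g \o u) = k.
Proof.
move=> Pl GGl GGcomp stage.
have [|u ru det] := @fusion (prefix_determined G Phi l) _ stage.
  move=> n u r ru det rr rn h h' Gh Gh' fh fh' hh'.
  have firstr g : first g l n -> first (g \o r) l n.
    move=> [gn hn]; split=> [|i i_n] /=; first by rewrite rn.
    by rewrite rn ?hn // ltnW.
  apply: (det (h \o r) (h' \o r)); try exact: GGcomp; try exact: firstr.
  by move=> i i_n /=; rewrite rn ?hh' // ltnW.
have /choice[d hd] : forall s : seq nat, exists k, forall h, G h ->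
    first h l (size s) -> (forall i, i < size s -> h i = nth 0 s i) ->
    Phi (h \o u) = k.
  move=> s; have [[h [Gh fh hs]]|nh] := pselect (exists h, [/\ G h,
      first h l (size s) & forall i, i < size s -> h i = nth 0 s i]).
    exists (Phi (h \o u)) => h' Gh' fh' hs'.
    by apply: (det (size s)) => // i i_s; rewrite hs' ?hs.
  by exists (Phi id) => h Gh fh hs; case: nh; exists h.
have [u' ru' [k hk]] := Pl K d.
exists (u' \o u); first exact: rigid_comp.
exists k => g Gg; have gl := GGl _ Gg.
have [q fq] := upto_comp gl ru' (leqnn l).
rewrite -(hk g q gl fq) -(hd _ (g \o u')) // ?size_mkseq //;
  first exact: GGcomp.
by move=> i iq; rewrite nth_mkseq.
Qed.

Definition firstpos (g : nat -> nat) (n : nat) : nat :=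
  xget 0 [set p | first g n p].

Lemma firstposE g n p : first g n p -> firstpos g n = p.
Proof. by move=> gp; apply: first_uniq (gp); apply: xgetPex; exists p. Qed.

Lemma assign_le n (b : nat -> 'I_n.+1) x : assign b x <= n.
Proof. by rewrite /assign; case: (leqP x n) => // _; rewrite -ltnS. Qed.

(** Every letter up to [l] occurs in [h] at one of the positions [0 ... n], so
    replacing variables by such positions suffices to obtain all words that
    factor through [h]. *)
Lemma ex_assign l n h : upto l h -> first h l n ->
  exists b : nat -> 'I_n.+1, forall x, h x <= l -> h (assign b x) = h x.
Proof.
move=> hl fl; exists (fun i => inord (firstpos h (h (n.+1 + i)))) => x hx.
rewrite /assign; case: (leqP x n) => // nx; rewrite subnKC //.
have [p fp] := hl _ hx; rewrite (firstposE fp) inordK ?fp.1 // ltnS.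
have := hx; rewrite leq_eqVlt => /orP[/eqP hxl|/(first_lt fp fl)/ltnW //].
by rewrite hxl in fp; rewrite (first_uniq fp fl).
Qed.

Section PrefixCode.
Context (n l : nat).

(** The restriction of [h] to [0 ... n] as an element of a finite type, which
    serves to index vectors of colors. *)
Definition prefix_code (h : nat -> nat) : {ffun 'I_n.+1 -> 'I_l.+1} :=
  [ffun b => inord (h (val b))].

Lemma first_le h : first h l n -> forall x, x <= n -> h x <= l.
Proof.
by move=> fh x; rewrite leq_eqVlt => /orP[/eqP ->|/fh.2/ltnW //]; rewrite fh.1.
Qed.

Lemma prefix_codeE h x : first h l n -> x <= n ->
  prefix_code h (inord x) = h x :> nat.
Proof.
move=> fh xn; have xE : (inord x : 'I_n.+1) = x :> nat by rewrite inordK.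
by rewrite ffunE /= xE inordK // ltnS (first_le fh).
Qed.

Lemma eq_prefix_code h h' : first h l n -> first h' l n ->
  (forall i, i < n -> h i = h' i) -> prefix_code h = prefix_code h'.
Proof.
move=> fh fh' hh'; apply/ffunP => b; rewrite !ffunE; congr inord.
have : b <= n by rewrite -ltnS.
by rewrite leq_eqVlt => /orP[/eqP /= ->|/hh' //]; rewrite fh.1 fh'.1.
Qed.

End PrefixCode.

(** Words over the positions [0 ... n] are colored by the vector of the colors
    that they receive from all possible prefixes of length [n + 1].  The first
    [l + 1] of [h] is at a position beyond [n], that is, at a variable of the
    homogeneous parameter word; so the composite of [h] and this word is, before
    its first [l + 1], an instance of this word read through [h]. *)
Lemma finite_stage (K : finType) (c : seq nat -> K) l n u : rigid u ->
  exists r, [/\ rigid r, forall i, i <= n -> r i = i &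
    prefix_determined (upto l.+1) (fun g =>
      c (mkseq g (firstpos g l.+1))) l n (r \o u)].
Proof.
move=> ru.
pose word (z : seq 'I_n.+1) := iota 0 n.+1 ++ map val z.
pose vec (z : seq 'I_n.+1) := [ffun s : {ffun 'I_n.+1 -> 'I_l.+1} =>
  c [seq val (s (inord (nth 0 (word z) x))) | x <- mkseq u (firstpos u (size
    (word z)))]].
have [w0 [t [k hk]]] := carlson_simpson vec ord0.
exists (pword w0 t); split; [exact: rigid_pword|exact: pword_le|].
pose sigma h := prefix_code n l h.
suff key h : upto l.+1 h -> first h l n ->
    c (mkseq (h \o (pword w0 t \o u)) (firstpos (h \o (pword w0 t \o u)) l.+1))
      = k (sigma h).
  move=> h h' hl hl' fh fh' hh';
    by rewrite !key // /sigma (eq_prefix_code fh fh' hh').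
move=> hl fh; have hl' : upto l h by move=> m ml; apply: hl; exact: leqW.
have [b hb] := ex_assign hl' fh.
have [p fp] := hl _ (leqnn _).
have /subnKC pE := first_lt fh fp (ltnSn l); move: (p - n.+1) pE => i pE.
have fr := first_pword w0 t i; rewrite pE in fr.
have [q fq] := ru (size (pword_pre w0 t i)).
rewrite (firstposE (first_comp fp (first_comp fr fq))).
rewrite -(hk b i) ffunE /word -assign_pword_pre size_map (firstposE fq).
congr c; rewrite -map_comp; apply/eq_in_map => j;
  rewrite mem_iota add0n => /andP[_ jq].
have uj := fq.2 _ jq; have ruj := fr.2 _ uj; have huj := fp.2 _ ruj.
by rewrite /= (nth_map 0) // -(pword_nth uj) prefix_codeE ?assign_le // hb.
Qed.

Theorem finite_ramseyP l : finite_ramsey l.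
Proof.
elim: l => [|l IH] K c.
  exists id; first exact: rigid_id.
  by exists (c [::]) => g [|q] // _ [_ /(_ 0 isT)].
have [| | |u ru [k hk]] := @ramsey_step K (upto l.+1)
    (fun g => c (mkseq g (firstpos g l.+1))) l IH.
- by move=> g gl n nl; apply: gl; exact: leqW.
- by move=> g u; exact: upto_comp.
- by move=> n u; exact: finite_stage.
exists u => //; exists k => g q gl fq.
by rewrite -(hk g gl) (firstposE fq).
Qed.

(** * The Baire property of Borel sets *)

Section BaireProperty.
Context (T : topologicalType).
Implicit Types C : set T.

Definition baire_property C : Prop := exists (O : set T) (D : nat -> set T),
  [/\ open O, forall n, open (D n) /\ dense (D n) &
      forall y, (forall n, D n y) -> (C y <-> O y)].

Lemma baire_open C : open C -> baire_property C.
Proof.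
move=> oC; exists C, (fun=> setT); split=> // n; split; first exact: openT.
by move=> U U0 _; rewrite setIT.
Qed.

Lemma baire_cst (P : Prop) : baire_property [set _ | P].
Proof.
apply: baire_open; have [p|np] := pselect P.
  by rewrite (_ : [set _ | P] = setT) ?predeqE //; exact: openT.
by rewrite (_ : [set _ | P] = set0) ?predeqE //; exact: open0.
Qed.

(** Up to the boundary of [O], which is nowhere dense, the complement of [O] is
    its own interior. *)
Lemma baire_setC C : baire_property C -> baire_property (~` C).
Proof.
move=> [O [D [oO oD CO]]]; pose O' := (~` O)°.
exists O', (fun n => if n is m.+1 then D m else O `|` O'); split.
- exact: open_interior.
- move=> [|m]; last exact: oD.
  split; first by apply: openU => //; exact: open_interior.
  move=> U [x Ux] oU; have [[z [Uz Oz]]|nUO] := pselect (U `&` O !=set0).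
    by exists z; split=> //; left.
  exists x; split=> //; right; apply: (@interiorS _ U).
    by move=> z Uz Oz; apply: nUO; exists z.
  by move: oU; rewrite openE; exact.
- move=> y Dy; have {}CO := CO _ (fun m => Dy m.+1).
  split=> [nCy|O'y /CO Oy]; last by have := interior_subset O'y.
  by have [/CO|] := Dy 0.
Qed.

Lemma baire_bigcup (I : countType) (C : I -> set T) :
  (forall i, baire_property (C i)) -> baire_property [set y | exists i, C i y].
Proof.
move=> /choice[O /choice[D hD]].
exists (\bigcup_(i in setT) O i), (fun n =>
  if unpickle n is Some (i, m) then D i m else setT); split.
- by apply: bigcup_open => i _; have [] := hD i.
- move=> n; case: unpickle => [[i m]|]; first by have [] := hD i.
  by split; [exact: openT|move=> U U0 _; rewrite setIT].
- move=> y Dy.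
  have CO i : C i y <-> O i y.
    have [_ _] := hD i; apply=> m.
    by have := Dy (pickle (i, m)); rewrite pickleK.
  by split=> [[i /CO Oy]|[i _ /CO Cy]]; exists i.
Qed.

Lemma baire_bigcap (I : countType) (C : I -> set T) :
  (forall i, baire_property (C i)) -> baire_property [set y | forall i, C i y].
Proof.
move=> hC; rewrite (_ : [set _ | _] = ~` [set y | exists i, (~` C i) y]).
  by apply/baire_setC/baire_bigcup => i; exact: baire_setC.
apply/seteqP; split=> [y Cy [i] /(_ (Cy i))//|y nC i].
by apply: contrapT => nCi; apply: nC; exists i.
Qed.

End BaireProperty.

Lemma borel_baire (S T : topologicalType) (f : S -> T) (C : set T) :
  continuous f -> <<s open >> C -> baire_property (f @^-1` C).
Proof.
move=> /continuousP cf.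
suff : <<s open >> `<=` [set E | baire_property (f @^-1` E)] by apply.
apply: smallest_sub; last first.
  by move=> O oO; apply: baire_open; exact: cf.
split=> [|E fE|F FC].
- by apply: baire_open; exact: open0.
- by rewrite setTD; exact: (baire_setC fE).
- rewrite /= (_ : _ @^-1` _ = [set y | exists i, (f @^-1` F i) y]).
    exact: baire_bigcup.
  by apply/seteqP; split=> y; [case=> i _ ?; exists i|case=> i ?; exists i].
Qed.

(** * Infinite words *)

Definition starts (B : Type) (y : nat -> B) (w : seq B) : Prop :=
  mkseq y (size w) = w.

Section Words.
Context (B : choiceType).
Local Notation space := {ptws nat -> discrete_topology B}.

Lemma near_coord (y : space) i : \forall z \near y, z i = y i.
Proof.
have := @proj_continuous nat (fun=> discrete_topology B) i y.
by move=> /(_ [set y i]); apply; exact: discrete_set1.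
Qed.

(** The cylinders around [y] generate a filter that converges to [y]
    coordinatewise, hence in the product topology. *)
Lemma nbhs_starts (y : space) (O : set space) : nbhs y O ->
  exists n, forall z : space, (forall i, i < n -> z i = y i) -> O z.
Proof.
pose F : set_system space := [set C | exists n, forall z : space,
  (forall i, i < n -> z i = y i) -> C z].
have FF : Filter F.
  split; first by exists 0.
  - move=> C D [n nC] [m mD]; exists (maxn n m) => z zy; split.
    + by apply: nC => i i_n; apply: zy; rewrite leq_max i_n.
    + by apply: mD => i im; apply: zy; rewrite leq_max im orbT.
  - by move=> C D CD [n nC]; exists n => z /nC /CD.
suff : F --> y by exact.
apply/pointwise_cvgP => i; apply/discrete_cvg.
by exists i.+1 => z; apply.
Qed.

Lemma open_starts (w : seq B) : open ([set y | starts y w] : set space).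
Proof.
rewrite openE => y yw; rewrite /interior /=.
have : \forall z \near y, forall i : 'I_(size w), z (val i) = y (val i).
  apply: (@filter_forall _ _ (fun (i : 'I_(size w)) (z : space) =>
    z (val i) = y (val i)) (nbhs y)) => i; exact: near_coord.
apply: filterS => z zy; rewrite /= /starts -[RHS]yw.
by apply/eq_in_map => i; rewrite mem_iota => /andP[_ iw];
  exact: (zy (Ordinal iw)).
Qed.

End Words.

Lemma starts_cat (B : Type) (y : nat -> B) w w' :
  starts y (w ++ w') -> starts y w.
Proof.
rewrite /starts size_cat => yw; have := congr1 (take (size w)) yw.
by rewrite take_size_cat // -map_take take_iota (minn_idPl (leq_addr _ _)).
Qed.

Lemma starts_nth (B : Type) (y : nat -> B) b0 w :
  starts y w <-> forall i, i < size w -> y i = nth b0 w i.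
Proof.
split=> [yw i iw|yw]; first by rewrite -[in RHS]yw nth_mkseq.
by apply: (@eq_from_nth _ b0); rewrite size_mkseq // => i iw;
  rewrite nth_mkseq // yw.
Qed.

(** * Generic left variable words *)

Section BaireLeftVariable.
Context (B : finType).
Local Notation space := {ptws nat -> discrete_topology B}.

Definition infinite_inst (w0 : seq B) (t : nat -> seq (option B)) (b y :
  nat -> B) : Prop :=
  forall n, starts y (inst w0 t b n).

Lemma ex_infinite_inst w0 t b : exists y, infinite_inst w0 t b y.
Proof.
have b0 := b 0.
have szn n : n <= size (inst w0 t b n).
  by elim: n => // n IH;
    rewrite size_cat /= addnS ltnS (leq_trans IH) // leq_addr.
have pre i j : i <= j -> exists s, inst w0 t b j = inst w0 t b i ++ s.
  move=> /subnKC <-; elim: (j - i) => [|k [s IH]].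
    by exists [::]; rewrite addn0 cats0.
  by rewrite addnS /= IH; eexists; rewrite -catA.
exists (fun i => nth b0 (inst w0 t b i.+1) i) => n;
  apply/(starts_nth _ b0) => i i_n.
case/orP: (leq_total n i.+1) => /pre [s ->].
  by rewrite [LHS]nth_cat i_n.
by rewrite [RHS]nth_cat (szn i.+1).
Qed.

(** The [m]-th left variable word is a variable followed by a constant word that
    forces all instances constructed so far into [E m]. *)
Lemma ex_generic_word (E : nat -> set space) w0 : B ->
  (forall m, open (E m) /\ dense (E m)) ->
  exists t, forall b y, infinite_inst w0 t b y -> forall m, E m y.
Proof.
move=> b0 oE.
have ext m (ws : seq (seq B)) : exists u :
  seq B, forall w, w \in ws -> forall y : nat -> B, starts y (w ++ u) -> E m y.
  elim: ws => [|w ws [u hu]]; first by exists [::].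
  have [om dm] := oE m.
  have [|y [/= yw Ey]] := dm _ _ (open_starts (w ++ u)).
    by exists (nth b0 (w ++ u)); apply/(starts_nth _ b0).
  have [n yn] := nbhs_starts (open_nbhs_nbhs (conj om Ey)).
  exists (u ++ mkseq (fun i => y (size (w ++ u) + i)) n) => w' + z.
  rewrite inE catA => /orP[/eqP -> zw|/hu zE /starts_cat /zE//];
    apply: yn => i i_n.
  move/(starts_nth _ b0): zw => zw.
  rewrite zw; last by rewrite size_cat size_mkseq (leq_trans i_n) // leq_addl.
  rewrite nth_cat; case: ltnP => [iw|wi];
    first by move/(starts_nth _ b0): yw => ->.
  by rewrite nth_mkseq ?subnKC // (leq_ltn_trans (leq_subr _ _) i_n).
pose G i (w : seq B) :=
  forall m, m < i -> forall y : nat -> B, starts y w -> E m y.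
have [||t ht] := @ex_left_variable_words B G w0.
- by [].
- move=> i ws wsG; have [u hu] :=
    ext i [seq w ++ [:: b] | w <- ws, b <- enum B].
  exists (map Some u) => w b wws m;
    rewrite ltnS leq_eqVlt => /orP[/eqP ->|mi] y.
    rewrite /plug -map_comp (_ : map _ u = u) ?map_id // -cat_rcons -cats1.
    by apply: hu; apply/allpairsP; exists (w, b); rewrite /= mem_enum.
  by move=> /starts_cat; exact: wsG.
- by exists t => b y yb m; apply: (ht m.+1 b m).
Qed.

(** Let [E] enumerate the dense open sets on whose intersection each color class
    agrees with an open set.  One generic point has an initial segment that
    decides its color; the generic parameter word is started from there. *)
Lemma baire_left_variable (K : finType) (c : space -> K) : B ->
  (forall k, baire_property (c @^-1` [set k])) ->
  exists w0 t k, forall b y, infinite_inst w0 t b y -> c y = k.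
Proof.
move=> b0 /choice[O /choice[D hD]].
pose E m := if unpickle m is Some (k, i) then D k i else [set: space].
have oE m : open (E m) /\ dense (E m).
  rewrite /E; case: unpickle => [[k i]|]; first by have [] := hD k.
  by split; [exact: openT|move=> U U0 _; rewrite setIT].
have EO (y : space) : (forall m, E m y) -> forall k, c y = k <-> O k y.
  move=> Ey k; have [_ _] := hD k; apply => i.
  by have := Ey (pickle (k, i)); rewrite /E pickleK.
have [t0 ht0] := @ex_generic_word E [::] b0 oE.
have [y0 hy0] := ex_infinite_inst [::] t0 (fun=> b0).
have Oy0 : O (c y0) y0 by apply/EO => //; exact: ht0 hy0.
have [oO _ _] := hD (c y0).
have [n hn] := nbhs_starts (open_nbhs_nbhs (conj oO Oy0)).
have [t ht] := @ex_generic_word E (mkseq y0 n) b0 oE.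
exists (mkseq y0 n), t, (c y0) => b y yb; apply/EO; first exact: ht yb.
apply: hn => i i_n; have /(starts_nth _ b0) -> := yb 0;
  last by rewrite size_mkseq.
by rewrite nth_mkseq.
Qed.

End BaireLeftVariable.

(** * The dual Ramsey theorem for Borel colorings *)

Definition onto (l : nat) (g : nat -> nat) : Prop :=
  upto l g /\ forall i, g i <= l.

(** Colors of Borel colorings have the Baire property after every continuous
    change of variables; this is what the proof needs, and it is stable under
    composition with a rigid surjection.  Continuity of [tau] is stated
    coordinatewise. *)
Definition baire_coloring (l : nat) (K : Type) (Phi : (nat -> nat) -> K) :
  Prop :=
  forall (B : finType) (tau : {ptws nat -> discrete_topology B} -> nat -> nat),
    (forall y, onto l (tau y)) ->
    (forall y i, \forall z \near y, tau z i = tau y i) ->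
    forall k, baire_property [set y | Phi (tau y) = k].

(** As in [finite_stage], with infinite words in place of finite ones.  A vector
    has an entry only for the codes [s] that come from a map onto
    [0 ... l]. *)
Lemma borel_stage (K : finType) (Phi : (nat -> nat) -> K) l n u :
  baire_coloring l Phi -> rigid u ->
  exists r, [/\ rigid r, forall i, i <= n -> r i = i &
    prefix_determined (onto l) Phi l n (r \o u)].
Proof.
move=> hPhi ru.
pose subs (s : {ffun 'I_n.+1 -> 'I_l.+1}) (x : nat) : nat := s (inord x).
pose tau s (y : nat -> 'I_n.+1) := subs s \o assign y \o u.
pose good s := `[< forall y : nat -> 'I_n.+1, onto l (subs s \o assign y) >].
pose vec (y : {ptws nat -> discrete_topology 'I_n.+1}) :=
  [ffun s => if good s then Some (Phi (tau s y)) else None].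
have vecP k : baire_property (vec @^-1` [set k]).
  rewrite (_ : _ @^-1` _ = [set y | forall s, vec y s = k s]); last first.
    by apply/seteqP; split=> [y /= -> //|y /= yk]; apply/ffunP.
  apply: baire_bigcap => s;
    rewrite -[X in baire_property X]/[set y | vec y s = k s].
  have [/asboolP gs|/negbTE ngs] := boolP (good s); last first.
    rewrite (_ : [set y | _] = [set _ | None = k s]); first exact: baire_cst.
    by apply/seteqP; split=> y /=; rewrite ffunE ngs.
  have gs' : good s by apply/asboolP.
  case ks: (k s) => [a|]; last first.
    rewrite (_ : [set y | _] = [set _ | False]); first exact: baire_cst.
    by apply/seteqP; split=> y //=; rewrite ffunE gs'.
  rewrite (_ : [set y | _] = [set y | Phi (tau s y) = a]); last first.
    by apply/seteqP; split=> y /=; rewrite ffunE gs'; [case|move=> ->].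
  have near_tau (y : {ptws nat -> discrete_topology 'I_n.+1}) i :
      \forall z \near y, tau s z i = tau s y i.
    rewrite /tau /= /assign; case: (leqP (u i) n) => _;
      first by apply: (@filterE _ _ (nbhs_filter y)).
    by apply: (@filterS _ _ (nbhs_filter y) _ _ _ (near_coord y (u i - n.+1)))
      => z /= ->.
  apply: hPhi near_tau _ => y; have [gu gl] := gs y.
  by split=> [|i]; [exact: upto_comp|exact: gl].
have [w0 [t [k hk]]] := baire_left_variable ord0 vecP.
exists (pword w0 t); split; [exact: rigid_pword|exact: pword_le|].
pose sigma h := prefix_code n l h.
suff key h : onto l h -> first h l n ->
  Some (Phi (h \o (pword w0 t \o u))) = k (sigma h).
  move=> h h' hl hl' fh fh' hh'.
  by apply: Some_inj; rewrite !key // /sigma (eq_prefix_code fh fh' hh').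
move=> [hl hle] fh.
(* Read through [h], the instance [y] and the parameter word agree. *)
have [b0 hb0] := ex_assign hl fh; have {hb0} hb x := hb0 x (hle x).
have sE x : x <= n -> subs (sigma h) x = h x by exact: prefix_codeE.
have good_h : good (sigma h).
  apply/asboolP => y; split=> [v vl|i]; last by rewrite /= sE ?assign_le.
  have [p fp] := hl _ vl; exists p.
  have pn : p <= n.
    move: vl; rewrite leq_eqVlt => /orP[/eqP vl|vl];
      last exact/ltnW/(first_lt fp fh).
    by rewrite vl in fp; rewrite (first_uniq fp fh).
  have aE i : i <= n -> assign y i = i by rewrite /assign => ->.
  split=> [|i ip] /=; first by rewrite aE // sE // fp.1.
  have i_n : i <= n by apply: leq_trans (ltnW ip) pn.
  by rewrite aE // sE // fp.2.
pose y j : 'I_n.+1 := inord (assign b0 (pword w0 t (n.+1 + j))).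
have yE x : h (pword w0 t x) = subs (sigma h) (assign y x).
  rewrite sE ?assign_le // /assign; case: (leqP x n) => xn;
    first by rewrite pword_le.
  by rewrite /y subnKC // inordK ?ltnS ?assign_le // hb.
have yb : infinite_inst w0 t b0 y.
  move=> i; apply/(starts_nth _ ord0) => j ji; apply: val_inj.
  have e := assign_pword_pre w0 t b0 i.
  have js : n.+1 + j < size (pword_pre w0 t i).
    by rewrite -(size_map (assign b0)) e size_cat size_iota size_map ltn_add2l.
  rewrite /y /= inordK ?ltnS ?assign_le // (pword_nth js) -(nth_map 0 0) // e.
  by rewrite nth_cat size_iota ltnNge leq_addr /= addKn (nth_map ord0).
rewrite -(hk _ _ yb) ffunE good_h; congr (Some (Phi _)).
by apply/funext => i; rewrite /tau /= yE.
Qed.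

Theorem borel_ramsey (K : finType) (Phi : (nat -> nat) -> K) l :
  baire_coloring l Phi ->
  exists2 u, rigid u & exists k, forall g, onto l g -> Phi (g \o u) = k.
Proof.
move=> hPhi; apply: (ramsey_step (@finite_ramseyP l)) =>
  [g []//|g u [gl gle] ru|n u].
  by split; [exact: upto_comp|move=> i; exact: gle].
exact: borel_stage.
Qed.

(** * Rigid surjections between chains and between their terms *)

(** If [b] is least in its fiber under [g], then the least [f]-preimage of [b]
    is least in its fiber under [g \o f]. *)
Lemma rigid_surjection_cancel (A B C : Type) (ltA : A -> A -> Prop)
    (ltB : B -> B -> Prop) (ltC : C -> C -> Prop) (f : A -> B) (g : B -> C) :
  well_ordering ltA -> well_ordering ltB -> well_ordering ltC ->
  rigid_surjection ltA ltB f -> rigid_surjection ltA ltC (g \o f) ->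
  rigid_surjection ltB ltC g.
Proof.
move=> woA woB woC [fs fr] [gfs gfr].
split=> [c|c1 c2 b1 b2 c12 h1 h2]; first by have [a <-] := gfs c; exists (f a).
have lift c b : least ltB (g @^-1` [set c]) b ->
    exists2 a, least ltA (f @^-1` [set b]) a & least ltA ((g \o f) @^-1` [set
      c]) a.
  move=> [/= gb bmin]; have [a0 fa0] := fs b.
  have [a al] := ex_least woA (P := f @^-1` [set b]) fa0.
  exists a => //; split=> [|a' /= gfa' a'a]; first by rewrite /= al.1.
  have [a'' a''l] := ex_least woA (P := f @^-1` [set f a']) erefl.
  have [lt|[eq|lt]] := wo_total woB (f a') b.
  - exact: (bmin _ gfa').
  - exact: (al.2 a').
  - have aa'' := fr _ _ _ _ lt al a''l.
    by apply: (a''l.2 a' erefl); exact: wo_trans aa''.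
have [a1 ha1 ga1] := lift _ _ h1; have [a2 ha2 ga2] := lift _ _ h2.
have a12 := gfr _ _ _ _ c12 ga1 ga2.
have [//|[b12|b21]] := wo_total woB b1 b2.
  by case: (wo_irr woC (x := c1)); rewrite -[in X in ltC _ X]h1.1 b12 h2.1.
by case: (wo_irr woA (x := a1)); apply: (wo_trans woA a12);
  exact: fr b21 ha2 ha1.
Qed.

Section TermMap.
Context (L : language).

Definition term_map (X Y : Type) (g : X -> Y) : term L X -> term L Y :=
  subst (fun x => Var (g x)).

Lemma subst_subst (X Y Z : Type) (g : X -> term L Y) (h : Y -> term L Z) t :
  subst h (subst g t) = subst (fun x => subst h (g x)) t.
Proof. by elim: t => //= f a IH; congr App; apply/funext. Qed.

Lemma subst_Var (X : Type) (t : term L X) : subst Var t = t.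
Proof. by elim: t => //= f a IH; congr App; apply/funext. Qed.

Definition symbol_map (X Y : Type) (g : X -> Y) (s : symbol L X) : symbol L Y :=
  match s with
  | SVar x => SVar (g x)
  | SConst c => SConst c
  | SFunc f => SFunc f
  | SLeft => SLeft
  | SComma => SComma
  | SRight => SRight
  end.

Lemma comma_sep_map (X Y : Type) (g : X -> Y) ss :
  comma_sep (map (map (symbol_map g)) ss) = map (symbol_map g) (comma_sep ss).
Proof. by elim: ss => // s [|s' ss] //= IH; rewrite map_cat /= -IH. Qed.

Lemma term_string_map (X Y : Type) (g : X -> Y) t :
  term_string (term_map g t) = map (symbol_map g) (term_string t).
Proof.
elim: t => //= f a IH; rewrite map_rcons -comma_sep_map -map_comp.
by congr [:: _, _ & rcons (comma_sep _) _]; apply: eq_map.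
Qed.

Lemma lex_map (S T : Type) (ltS : S -> S -> Prop) (ltT : T -> T -> Prop) phi :
  (forall x y, ltS x y -> ltT (phi x) (phi y)) ->
  forall u v, lex ltS u v -> lex ltT (map phi u) (map phi v).
Proof.
move=> mono; elim=> [|x u IH] [|y v] //= [/mono|[-> /IH]]; [by left|by right].
Qed.

Lemma lex_map_le (S : Type) (ltS : S -> S -> Prop) (phi : S -> S) :
  (forall x, phi x = x \/ ltS (phi x) x) ->
  forall u, map phi u = u \/ lex ltS (map phi u) u.
Proof.
move=> dec; elim=> [|x u [IH|IH]] /=; first by left.
  by have [->|] := dec x; [left; rewrite IH|right; left].
by have [->|] := dec x; right; [right|left].
Qed.

Section RigidTermMap.
Context (X Y : chain) (g : X -> Y).
Hypothesis g_rigid : rigid_surjection (@chain_lt X) (@chain_lt Y) g.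

(** Let [v] choose least preimages under [g].  It is strictly monotone and maps
    the least variable to the least variable, so it commutes with shapes and is
    monotone for the neat order.  As [v (g x) <= x], applying [v \o g] to the
    variables of a term can only lower it; hence substituting [v] gives the
    least preimage of a term. *)
Lemma rigid_term_map :
  rigid_surjection (@neat_lt L X) (@neat_lt L Y) (term_map g).
Proof.
have [gs gr] := g_rigid.
have /choice[v hv] : forall y, exists x,
  least (@chain_lt X) (g @^-1` [set y]) x.
  by move=> y; have [x gx] := gs y; apply: (ex_least (chain_wo X) (x := x)).
have gv y : g (v y) = y by case: (hv y).
have vmono y y' : chain_lt y y' -> chain_lt (v y) (v y') by move=> /gr; apply.
have vle x : v (g x) = x \/ chain_lt (v (g x)) x.
  have [|[|lt]] := wo_total (chain_wo X) (v (g x)) x; [by right|by left|].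
  by case: ((hv (g x)).2 x).
have vmin : v (chain_min Y) = chain_min X.
  have [_ minX] := chain_minP X; have [_ minY] := chain_minP Y.
  have [lt|[//|lt]] := wo_total (chain_wo X) (v (chain_min Y)) (chain_min X).
    by case: (minX _ I lt).
  have [e|/vmono lt'] : g (chain_min X) = chain_min Y \/
      chain_lt (chain_min Y) (g (chain_min X)).
    have [lt'|[e|lt']] := wo_total (chain_wo Y) (g (chain_min X)) (chain_min Y);
      [by case: (minY _ I lt')|by left|by right].
  - by case: ((hv (chain_min Y)).2 (chain_min X)).
  - have [e|lt''] := vle (chain_min X); last by case: (minX _ I lt'').
    by rewrite e in lt'; case: (minX _ I lt').
have smono s s' : symbol_lt s s' ->
    symbol_lt (symbol_map v s : symbol L X) (symbol_map v s').
  by case: s s' => [y|c|f|||] [y'|c'|f'|||] //=; exact: vmono.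
have len_map t : term_length (term_map v t) = term_length t.
  by rewrite /term_length term_string_map size_map.
have shape_map t : shape (term_map v t) = term_map v (shape t).
  by rewrite /shape /term_map !subst_subst /= vmin.
have mono s t : neat_lt s t -> neat_lt (term_map v s) (term_map v t).
  rewrite /neat_lt !len_map !shape_map !term_string_map.
  move=> [|[e [h|[-> h]]]]; [by left|right; split=> //; left|right; split=> //;
    right].
    exact: lex_map h.
  by split=> //; exact: lex_map h.
have gvK s : term_map g (term_map v s) = s.
  rewrite /term_map subst_subst -[RHS]subst_Var; congr (subst _ s).
  by apply/funext => y /=; rewrite gv.
have dec t : term_map v (term_map g t) = t \/
    neat_lt (term_map v (term_map g t)) t.
  have e : term_string (term_map v (term_map g t)) =
      map (symbol_map v \o symbol_map g) (term_string t).
    by rewrite !term_string_map map_comp.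
  have [h|h] : map (symbol_map v \o symbol_map g) (term_string t) = term_string
    t \/
      lex (@symbol_lt L X) (map (symbol_map v \o symbol_map g) (term_string t))
        (term_string t).
    apply: lex_map_le => -[x|c|f|||] /=; try (by left).
    by have [->|] := vle x; [left|right].
  - by left; apply: term_string_inj; rewrite e.
  - right; right; split; first by rewrite /term_length e size_map.
    right; split; last by rewrite e.
    by rewrite /shape /term_map !subst_subst.
have v_least s : least (@neat_lt L X) (term_map g @^-1` [set s]) (term_map v s).
  split=> [|t /= <- lt]; first exact: gvK.
  have wo := neat_wo L X; have [e|lt'] := dec t.
    by rewrite e in lt; exact: (wo_irr wo lt).
  exact: (wo_irr wo (wo_trans wo lt lt')).
split=> [s|s s' t t' ss' ht ht']; first by exists (term_map v s); exact: gvK.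
rewrite (least_uniq (neat_wo L X) ht (v_least s)).
by rewrite (least_uniq (neat_wo L X) ht' (v_least s')); exact: mono.
Qed.

End RigidTermMap.
End TermMap.

Lemma first_rigid_surjection (Y : chain) (r : Y -> nat) (g : nat -> Y) :
  injective r -> (forall y y', chain_lt y y' -> r y < r y') ->
  (forall y, exists p, first (r \o g) (r y) p) ->
  rigid_surjection (@chain_lt omega) (@chain_lt Y) g.
Proof.
move=> rI rmono gf.
split=> [y|y1 y2 a1 a2 y12 h1 h2]; first by have [p [/rI <-]] := gf y; exists p.
have leastE y a : least (@chain_lt omega) (g @^-1` [set y]) a ->
  first (r \o g) (r y) a.
  move=> [/= ga amin]; have [p fp] := gf y.
  have gp : g p = y by apply: rI; exact: fp.1.
  have [lt|lt|->//] := ltngtP a p; last by case: (amin _ gp).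
  by have := fp.2 _ lt; rewrite /= ga ltnn.
exact: first_lt (leastE _ _ h1) (leastE _ _ h2) (rmono _ _ y12).
Qed.

Lemma rigid_rigid_surjection u : rigid u ->
  rigid_surjection (@chain_lt omega) (@chain_lt omega) u.
Proof. by move=> ru; apply: (@first_rigid_surjection omega id) => //. Qed.

Lemma ord_wo n : well_ordering (fun i j : 'I_n => i < j).
Proof.
split.
- by move=> i j k; exact: ltn_trans.
- move=> i j; have [|[/val_inj|]] := wo_total ltn_wo (val i) (val j); by auto.
- apply: wf_least => P i Pi.
  have [|_ [[j Pj <-] jmin]] := ex_least ltn_wo (P := val @` P) (x := val i).
    by exists i.
  by exists j; split=> // j' Pj'; apply: jmin; exists j'.
Qed.

Lemma ord0_least l : least (fun i j : 'I_l.+1 => i < j) setT ord0.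
Proof. by []. Qed.

Definition ord_chain (l : nat) : chain := Chain (ord_wo l.+1) (ord0_least l).

Lemma onto_rigid_surjection l g : onto l g ->
  rigid_surjection (@chain_lt omega) (@chain_lt (ord_chain l)) (fun x =>
    inord (g x)).
Proof.
move=> [gl gle]; apply:
  (@first_rigid_surjection (ord_chain l) (@nat_of_ord l.+1)) => [|//|y].
  exact: ord_inj.
have yl : y <= l by rewrite -ltnS.
have [p fp] := gl _ yl; exists p.
rewrite (_ : _ \o _ = g) //; apply/funext => x /=.
by rewrite inordK // ltnS.
Qed.

(** * Finite well-ordered sets *)

Lemma finite_wo_rank (T : Type) (lt : T -> T -> Prop) (m : nat) (a0 : T) :
  well_ordering lt -> [set: T] #= `I_m ->
  exists (rk : T -> nat) (al : nat -> T),
    [/\ forall a, rk a < m, cancel rk al, forall i, i < m -> rk (al i) = i &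
      forall a b, rk a < rk b <-> lt a b].
Proof.
move=> wo /card_set_bijP[f [fm finj fsurj]].
pose C : eqType := {classic T}.
pose leT (a b : C) := `[< a = b \/ lt a b >].
have [g hg] : exists g : nat -> T, forall i, i < m -> f (g i) = i.
  have /choice[g hg] : forall i, exists a, i < m -> f a = i.
    move=> i; have [im|im] := pselect (i < m); last by exists a0.
    by have [a _ fa] := fsurj i im; exists a.
  by exists g.
pose s : seq C := sort leT (map g (iota 0 m)).
have ss : size s = m by rewrite size_sort size_map size_iota.
have us : uniq s.
  rewrite sort_uniq map_inj_in_uniq ?iota_uniq // => i j.
  by rewrite !mem_iota /= => im jm e; rewrite -(hg i im) -(hg j jm) e.
have sT (a : C) : a \in s.
  rewrite mem_sort; have fam : f a < m by exact: fm.
  have <- : g (f a) = a by apply: finj; rewrite ?inE // hg.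
  by apply: map_f; rewrite mem_iota.
have leTtr : transitive leT.
  move=> b a c /asboolP[->//|ab] /asboolP[<-|bc]; apply/asboolP; right=> //.
  exact: wo_trans bc.
have leTtot : total leT.
  move=> a b; apply/orP.
  have [ab|[->|ba]] := wo_total wo a b.
  - by left; apply/asboolP; right.
  - by left; apply/asboolP; left.
  - by right; apply/asboolP; right.
have ssort : sorted leT s by exact: sort_sorted.
have rk_lt (a b : C) : index a s < index b s -> lt a b.
  move=> ab; have /asboolP[e|//] :=
    sorted_ltn_index leTtr ssort a b (sT a) (sT b) ab.
  by rewrite e ltnn in ab.
exists (fun a : C => index a s), (nth a0 s); split.
- by move=> a; rewrite -ss index_mem.
- by move=> a; exact: (nth_index (a0 : C) (sT a)).
- by move=> i im; apply: (index_uniq (a0 : C)); rewrite ?ss.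
- move=> a b; split; first exact: rk_lt.
  move=> ab; case: (ltngtP (index (a : C) s) (index (b :
    C) s)) => // [/rk_lt ba|e].
    by case: (wo_irr wo (wo_trans wo ab ba)).
  by move: ab; rewrite -[a](nth_index (a0 :
    C) (sT a)) e nth_index // => /(wo_irr wo).
Qed.

(** * Homomorphisms from the free algebra *)

Section Extension.
Context (L : language) (V : variety L).
Local Notation S := (free_object V omega).

Section Hat.
Context (A : object V).
Implicit Types e : nat -> A.

Definition hat e : S -> A := fun c => eval (A := A) e (repr c).

Lemma hat_nu e t : hat e (nu V t) = eval (A := A) e t.
Proof.
have : nu V (repr (nu V t)) = nu V t by rewrite /nu reprK.
by move/nuP => /(_ A (obj_in_variety A)); exact.
Qed.

Lemma hat_comp_nu e : hat e \o nu V (X := omega) = eval (A := A) e.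
Proof. by apply/funext => t; exact: hat_nu. Qed.

Lemma hat_homomorphism e : homomorphism (hat e : free_algebra V omega -> A).
Proof.
split=> [c|f a]; first by rewrite /= hat_nu.
by rewrite /= hat_nu /=.
Qed.

Lemma homomorphism_hat (f : S -> A) : homomorphism f ->
  f = hat (fun i => f (nu V (Var (i : omega)))).
Proof.
move=> [fc ff]; apply/funext => c; rewrite -[c]reprK -/(nu V (repr c)) hat_nu.
elim: (repr c) => [x|k|k a IH] //=; first by rewrite -fc.
by rewrite nu_App ff; congr alg_func; apply/funext.
Qed.

(** The quotient map from terms is itself rigid, so it can be composed and
    cancelled. *)
Lemma hat_rigid e :
  rigid_epimorphism (A := S) (hat e) <->
  rigid_surjection (@neat_lt L omega) (@obj_lt L V A) (eval (A := A) e).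
Proof.
rewrite -hat_comp_nu; split=> [[_ hr]|hr].
  apply: rigid_surjection_comp (nu_rigid V omega) hr; first exact: neat_wo.
  exact: free_wo.
split; first exact: hat_homomorphism.
apply: rigid_surjection_cancel (nu_rigid V omega) hr.
- exact: neat_wo.
- exact: free_wo.
- exact: obj_wo.
Qed.

(** Evaluation under [al \o g] factors through the terms in [l + 1] variables by
    the rigid map induced by [g]; the second factor is the same for [g']. *)
Lemma hat_onto_rigid (al : nat -> A) l g g' : onto l g -> onto l g' ->
  rigid_epimorphism (A := S) (hat (al \o g)) -> rigid_epimorphism (A :=
    S) (hat (al \o g')).
Proof.
move=> og og' /hat_rigid rg; apply/hat_rigid.
have factor h : onto l h -> eval (A := A) (al \o h) =
    eval (A := A) (fun y : ord_chain l => al (val y)) \o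
    term_map (L := L) (fun x : omega => inord (h x) : ord_chain l).
  move=> [_ hl]; apply/funext => t; rewrite /= /term_map eval_subst;
    congr (eval _ t).
  by apply/funext => x /=; rewrite inordK // ltnS.
rewrite factor //; apply:
  rigid_surjection_comp (rigid_term_map L (onto_rigid_surjection og')) _.
- exact: neat_wo.
- exact: neat_wo.
rewrite factor // in rg.
apply: rigid_surjection_cancel (rigid_term_map L (onto_rigid_surjection og)) rg.
- exact: neat_wo.
- exact: neat_wo.
- exact: obj_wo.
Qed.

Lemma near_hat (T : topologicalType) (e : T -> nat -> A) (y : T) :
  (forall i, \forall z \near y, e z i = e y i) ->
  forall c, \forall z \near y, hat (e z) c = hat (e y) c.
Proof.
move=> he c; rewrite /hat; elim: (repr c) => [i|k|k a IH] /=.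
- exact: he.
- exact: filterE.
- have : \forall z \near y, forall i, eval (A := A) (e z) (a i) = eval (A :=
    A) (e y) (a i).
    exact: filter_forall.
  by apply: filterS => z hz; congr alg_func; apply/funext.
Qed.

(** The least preimage of [b] lies below that of the value at the variable [i],
    hence below the class of this variable; but only variables precede a
    variable in the neat order. *)
Lemma rigid_hat_values f : rigid_epimorphism (A := S) f -> forall i (b : A),
  obj_lt b (f (nu V (Var (i : omega)))) ->
  exists2 i', i' < i & f (nu V (Var (i' : omega))) = b.
Proof.
move=> [_ [fs fr]] i b blt.
have woS : well_ordering (@free_lt L V omega) by exact: free_wo.
have woT := neat_wo L omega.
have [c0 fc0] := fs b.
have [c1 h1] := ex_least woS (P := f @^-1` [set b]) fc0.
have [c2 h2] := ex_least woS (P :=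
  f @^-1` [set f (nu V (Var (i : omega)))]) erefl.
have [s [t [hs ht st]]] := fr _ _ _ _ blt h1 h2.
have [s' hs'] := ex_least_nu (nu V (Var (i : omega)) : free_algebra V omega).
have lt_i : neat_lt s (Var (i : omega)).
  have s'i : s' = Var (i : omega) \/ neat_lt s' (Var (i : omega)).
    have [|[|lt]] := wo_total woT s' (Var (i : omega)); [by right|by left|].
    by case: (hs'.2 (Var (i : omega))).
  have ts' : t = s' \/ neat_lt t s'.
    have [|[|lt]] := wo_total woT t s'; [by right|by left|].
    case: (h2.2 (nu V (Var (i : omega))) erefl).
    by exists s', t.
  have ss' : neat_lt s s'.
    by case: ts' => [<-//|]; exact: (wo_trans woT).
  by case: s'i => [<-//|]; exact: (wo_trans woT).
have [i' ii' sE] : exists2 i', i' < i & s = Var (i' : omega).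
  case: s lt_i {hs st} => [i'|k|k a] [|[len]] //.
  - by case=> [[//|[_ []]]|[_ [lt|[_ []]]]]; exists i'.
  - by case=> [[//|[_ []]]|[_ [//|[_ []]]]].
by exists i' => //; rewrite -h1.1 -sE; congr f; exact: hs.1.
Qed.

End Hat.

End Extension.

(** * Colorings of rigid epimorphisms *)

Lemma baire_coloring_comp l (K : Type) (Phi : (nat -> nat) -> K) u :
  rigid u -> baire_coloring l Phi -> baire_coloring l (fun g => Phi (g \o u)).
Proof.
move=> ru hPhi B tau otau ntau;
  apply: (hPhi B (fun y => tau y \o u)) => [y|y i].
  by have [gl gle] := otau y; split; [exact: upto_comp|move=> i; exact: gle].
exact: ntau.
Qed.

Lemma borel_ramsey_upto (K : finType) (Phi : nat -> (nat -> nat) -> K) m : K ->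
  (forall l, baire_coloring l (Phi l)) ->
  exists2 u, rigid u & exists k : nat -> K, forall l, l < m ->
    forall g, onto l g -> Phi l (g \o u) = k l.
Proof.
move=> k0 hPhi; elim: m => [|m [u ru [k hk]]].
  by exists id; [exact: rigid_id|exists (fun=> k0)].
have [v rv [km hkm]] := borel_ramsey (baire_coloring_comp ru (hPhi m)).
exists (v \o u); first exact: rigid_comp.
exists (fun l => if l == m then km else k l) => l; rewrite ltnS leq_eqVlt.
case: eqP => [-> _ g og|_ /= lm g [gl gle]]; first exact: hkm.
apply: (hk l lm (g \o v)); split; [exact: upto_comp|by move=> i; exact: gle].
Qed.

(** [l] is the largest value of [g]; the growth condition makes the first
    occurrences of smaller letters come earlier. *)
Lemma growth_onto (g : nat -> nat) m : (forall i, g i < m) ->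
  (forall i n, n < g i -> exists2 i', i' < i & g i' = n) ->
  exists2 l, l < m & onto l g.
Proof.
move=> gm growth.
pose val_of n := `[< exists i, g i = n >].
have ex : exists n, val_of n by exists (g 0); apply/asboolP; exists 0.
have bd n : val_of n -> n <= m by move=> /asboolP[i <-]; exact/ltnW.
case: (ex_maxnP ex bd) => l /asboolP[i0 gi0] lmax.
exists l; first by rewrite -gi0.
split=> [n nl|i]; last by apply: lmax; apply/asboolP; exists i.
have exn : exists p, g p == n.
  move: nl; rewrite leq_eqVlt -gi0 => /orP[/eqP ->|/growth[p _ <-]];
    by [exists i0|exists p].
case: (ex_minnP exn) => p /eqP gp pmin; exists p; split=> // i ip.
case: (ltngtP (g i) n) => // [/growth[i' i'i gi']|gi].
  by have := pmin i'; rewrite gi' eqxx leqNgt (ltn_trans i'i ip) => /(_ isT).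
by have := pmin i; rewrite gi eqxx leqNgt ip => /(_ isT).
Qed.

Section Degree.
Context (L : language) (V : variety L) (A : object V).
Local Notation S := (free_object V omega).

Definition hat_hom (e : nat -> A) (h : rigid_epimorphism (A :=
  S) (hat e)) : hom S A :=
  exist (fun f => f \in hom S A) (hat e : S -> A) (mem_set h).

Lemma continuous_hat_hom (T : topologicalType) (e : T -> nat -> A)
    (h : forall y, rigid_epimorphism (A := S) (hat (e y))) :
  (forall y i, \forall z \near y, e z i = e y i) ->
  continuous (fun y => hat_hom (h y)).
Proof.
move=> he; apply: continuous_comp_initial => y.
apply: (iffRL (@pointwise_cvgP (discrete_topology {classic S})
  (discrete_topology {classic A}) _ (hat (e y)) _)) => c.
by apply/discrete_cvg; exact: (near_hat (he y) c).
Qed.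

(** The maps that do not extend to a rigid epimorphism get the color [k0].  This
    does no harm to the Baire property, as by [hat_onto_rigid] either all maps
    onto [0 ... l] extend or none does. *)
Lemma baire_coloring_hat (k : nat) (chi : hom S A -> 'I_k) (k0 : 'I_k) (al :
  nat -> A) l :
  borel_coloring chi ->
  baire_coloring l (fun g => if pselect (rigid_epimorphism (A :=
    S) (hat (al \o g))) is left h
    then chi (hat_hom h) else k0).
Proof.
move=> bchi B tau otau ntau c.
have [[y0 r0]|nr] := pselect (exists y, rigid_epimorphism (A :=
  S) (hat (al \o tau y))).
  have r y : rigid_epimorphism (A := S) (hat (al \o tau y)).
    exact: hat_onto_rigid r0.
  rewrite (_ : [set y | _] = (fun y =>
    hat_hom (r y)) @^-1` (chi @^-1` [set c])).
    apply: borel_baire (bchi c); apply: continuous_hat_hom => y i.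
    by apply: filterS (ntau y i) => z /= ->.
  apply/seteqP; split=> y /=; case: pselect => // h;
    by rewrite (_ : hat_hom h = hat_hom (r y)) //; exact: eq_exist.
rewrite (_ : [set y | _] = [set _ | k0 = c]); first exact: baire_cst.
by apply/seteqP; split=> y /=; case: pselect => // h; case: nr; exists y.
Qed.

End Degree.

Lemma rigid_endo (L : language) (V : variety L) u : rigid u ->
  rigid_epimorphism (A := free_object V omega) (B := free_object V omega)
    (hat (A := free_object V omega) (fun i => nu V (Var (u i : omega)))).
Proof.
move=> ru; apply/hat_rigid.
have -> : eval (A := free_algebra V omega) (fun i => nu V (Var (u i : omega))) =
    (nu V (X := omega) \o term_map (L := L) (u : omega -> omega)
      : term L omega -> free_algebra V omega).
  by apply/funext => t; rewrite /= -eval_free.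
apply: rigid_surjection_comp (rigid_term_map L (rigid_rigid_surjection ru))
  (nu_rigid V omega);
  exact: neat_wo.
Qed.

(** The map [f] followed on the variables by the ranking of [A] is onto
    [0 ... l] for some [l < m], and its color after composition with [w] is
    [col l]. *)
Lemma degree_bound_card (L : language) (V : variety L) (A : object V) m :
  [set: A] #= `I_m -> degree_bound A (free_object V omega) m.
Proof.
move=> cardA k k2 chi bchi; have [a0] := alg_nonempty A.
have [rk [al [rk_lt rkK alK rkP]]] := finite_wo_rank a0 (obj_wo A) cardA.
have k0 : 'I_k by exact: (Ordinal (ltnW k2)).
have [u ru [col hcol]] := borel_ramsey_upto m k0
  (fun l => @baire_coloring_hat _ _ _ _ chi k0 al l bchi).
pose w : hom (free_object V omega) (free_object V omega) :=
  hat_hom (rigid_endo V ru).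
exists w; apply: card_le_trans (card_image_le col `I_m); apply: subset_card_le.
move=> _ [f _ <-]; have fr := set_mem (valP f).
pose e i := val f (nu V (Var (i : omega))).
have [l lm og] : exists2 l, l < m & onto l (rk \o e).
  apply: growth_onto => [i|i n]; first exact: rk_lt.
  move=> nb; have nm : n < m by apply: ltn_trans nb _; exact: rk_lt.
  have [|i' i'i e'] := rigid_hat_values fr (i := i) (b := al n).
    by apply/rkP; rewrite alK.
  by exists i' => //=; rewrite /e e' alK.
exists l => //; rewrite -(hcol l lm _ og).
have fE : val f \o val w = hat (al \o ((rk \o e) \o u)).
  have [hh _] := set_mem (valP (hom_comp f w));
    apply: etrans (homomorphism_hat hh) _.
  by congr hat; apply/funext => i; rewrite /= hat_nu /= rkK.
case: pselect => [h|[]]; last by rewrite -fE;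
  exact: (set_mem (valP (hom_comp f w))).
by congr chi; exact: eq_exist.
Qed.

Theorem theorem4p16 (L : language) (V : variety L) (A : object V) (m : nat) :
  countable_language L ->
  nontrivial_variety V ->
  [set: A] #= `I_m ->
  exists2 d, big_dual_ramsey_degree A (free_object V omega) = Some d
    & (d <= m)%N.
Proof.
move=> _ _ cardA; have bound := degree_bound_card cardA.
have m_gt0 : 0 < m.
  have [a0] := alg_nonempty A.
  have [rk [_ [rk_lt _ _ _]]] := finite_wo_rank a0 (obj_wo A) cardA.
  exact: leq_ltn_trans (rk_lt a0).
rewrite /big_dual_ramsey_degree; case: pselect => [ex|[]]; last first.
  by exists m; rewrite m_gt0; apply/asboolP.
exists (ex_minn ex) => //; case: ex_minnP => d _ dmin.
by apply: dmin; rewrite m_gt0; apply/asboolP.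
Qed.
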